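(* Let $0<\alpha\le 0.05$, let $\mathbf{x}\in\mathbb{R}^N$, let $s_{ij}$ ($1\le i\le N$, $1\le j\le M$) be i.i.d. $S(\alpha,1)$, $y_j=\sum_{i=1}^Nx_is_{ij}$, and $\hat x_{i,min}=y_t/s_{it}$ with $t=\arg\min_{1\le j\le M}|y_j/s_{ij}|$. Let $\epsilon>0$, fix a coordinate $i$ with $|x_i|>\epsilon$, and let $\theta_i=\left(\sum_{t\ne i}|x_t|^\alpha\right)^{1/\alpha}>0$. Assume $\left(\frac{|x_i|+\epsilon}{\theta_i}\right)^{\alpha/(1-\alpha)}<1/3$. Then $$\Pr\left(|\hat x_{i,min}|\le\epsilon\right)\le 1-\left[1-\frac34\left|\frac{|x_i|+\epsilon}{\theta_i}\right|^{\frac{\alpha}{1+\alpha}}\left(1-\left|\frac{|x_i|-\epsilon}{|x_i|+\epsilon}\right|^{\alpha/(1-\alpha)}\right)\right]^M.$$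
   Context: A random variable $Z$ has the symmetric $\alpha$-stable distribution with unit scale, $S(\alpha,1)$, if its characteristic function is $E e^{\sqrt{-1}Zt}=e^{-|t|^\alpha}$. *)

(* Defs.v *)
From HB Require Import structures.
From mathcomp Require Import all_boot all_order all_algebra.
From mathcomp Require Import all_classical all_reals all_analysis.
Set Implicit Arguments. Unset Strict Implicit. Unset Printing Implicit Defensive.
Import Order.TTheory GRing.Theory Num.Theory.
Import numFieldNormedType.Exports.
Local Open Scope classical_set_scope.
Local Open Scope ring_scope.

(* Z has the symmetric alpha-stable law S(alpha,1):
   E[exp(sqrt(-1) t Z)] = exp(-|t|^alpha) for all real t,
   written via real and imaginary parts of the characteristic function. *)
Definition is_SaS d (T : measurableType d) (R : realType) (P : probability T R)
  (alpha : R) (Z : {RV P >-> R}) : Prop :=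
  forall t : R,
    ('E_P[(fun w => cos (t * Z w))] = (expR (- (`|t| `^ alpha)))%:E)%E /\
    ('E_P[(fun w => sin (t * Z w))] = 0%:E)%E.

(* mutual independence of a finite family of real random variables indexed
   by 'I_N x 'I_M : product rule for every family of Borel sets (taking
   B = setT for unconstrained indices gives all subfamilies). *)
Definition mutually_independent d (T : measurableType d) (R : realType)
  (P : probability T R) (N M : nat) (s : 'I_N -> 'I_M -> {RV P >-> R}) : Prop :=
  forall B : 'I_N -> 'I_M -> set R,
    (forall i j, measurable (B i j)) ->
    P (\bigcap_(k in [set: 'I_N * 'I_M]) (s k.1 k.2 @^-1` B k.1 k.2)) =
    (\prod_(i < N) \prod_(j < M) P (s i j @^-1` B i j))%E.

Definition meas d (T : measurableType d) (R : realType) (P : probability T R)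
  (N M : nat) (x : 'I_N -> R) (s : 'I_N -> 'I_M -> {RV P >-> R})
  (j : 'I_M) (w : T) : R :=
  \sum_(k < N) x k * s k j w.

Definition xhat_min d (T : measurableType d) (R : realType) (P : probability T R)
  (N M : nat) (hM : (0 < M)%N) (x : 'I_N -> R)
  (s : 'I_N -> 'I_M -> {RV P >-> R}) (i : 'I_N) (w : T) : R :=
  let t := Order.arg_min (Ordinal hM) xpredT (fun j : 'I_M => `|meas x s j w / s i j w|) in
  meas x s t w / s i t w.

Definition theta (R : realType) (N : nat) (alpha : R) (x : 'I_N -> R) (i : 'I_N) : R :=
  (\sum_(k < N | k != i) `|x k| `^ alpha) `^ (1 / alpha).

(* Main.v *)
Require Import Defs.
From HB Require Import structures.
From mathcomp Require Import all_boot all_order all_algebra.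
From mathcomp Require Import all_classical all_reals all_analysis.
From mathcomp Require Import measurable_realfun ring lra.
Import Order.TTheory GRing.Theory Num.Theory.
Import numFieldNormedType.Exports.
Local Open Scope classical_set_scope.
Local Open Scope ring_scope.

(** Write a for alpha, S for s_ij, Z for the sum of x_k s_kj over k <> i, and
    sg for the sign.  For 0 < c < b, the ratio Z / S lies in [c, b] exactly when
    S - Z / b and S - Z / c have different signs (up to null events), whence
    P (c <= Z / S <= b) = 1/2 E[sg S (sg (S - Z / b) - sg (S - Z / c))].  Signs are turned into
    characteristic functions by
      pi / 2 * sg y = int_0^oo y / (l^2 + y^2) dl
                    = int_0^oo int_0^oo e^(- l t) sin (t y) dt dl,
    where each integration is absolutely convergent against P.  Applied to both
    signs, all remaining integrands are nonnegative, so that Tonelli replaces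
    the kernel e^(- l t) by 1 / t, and e^(- p) - e^(- q) <= q - p gives
      E[sg S sin (t S)] <= (t^a / pi) * I,
      I = int_0^oo ((1 + z)^a - |1 - z|^a) / z dz <= 27 / 4 * a.
    The outer integral is explicit and yields
    P (c <= Z / S <= b) <= I / (pi^2 a) * (b^a - c^a) / theta^a, where
    I / (pi^2 a) <= 3/4 because pi >= 3.  The event for the minimum estimator is
    the union over the independent columns j of such events. *)

(** The law of S is known only through its characteristic function, so there is no density to
    integrate against, and sg S has to be expanded by the same integral as the two outer signs. The
    weight sg S serves to separate the variables: S and Z are independent and E sin (t Z) = 0, hence
    E[sg S sin (t (S - Z / v))] = E[sg S sin (t S)] e^(- (theta t / v)^a) for t > 0. Subtracting the
    cases v = b and v = c leaves a nonnegative difference of exponentials, explicitly integrable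
    against t^a dt / t. The detour through y / (l^2 + y^2) avoids the Dirichlet integral of sin (t
    y) / t, which converges only conditionally. The integral I is not evaluated: on each side of z =
    1 the integrand is replaced by a majorant with an explicit primitive, and for a <= 1/20 the loss
    fits into 27/4 = 9 * 3/4, where 9 <= pi^2. Each column thus obeys a bound with exponent a
    throughout; the exponents a / (1 + a) and a / (1 - a) enter at the end by monotonicity, as b /
    theta <= 1 and c / b < 1. *)

(** * Independence of generated sigma-algebras *)

Section independence.
Context {d : measure_display} {T : measurableType d} {R : realType}.
Variable P : probability T R.
Local Open Scope ereal_scope.

(** Dynkin's uniqueness argument, one index at a time: with the other sets fixed and B their
    intersection, the finite measures X -> P (X and B) and X -> P X times the remaining product
    agree on the pi-system [G k], hence on the sigma-algebra it generates. *)
Lemma product_rule_sigma_algebra (I : finType) (G : I -> set (set T)) :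
  (forall i, G i `<=` measurable) -> (forall i, setI_closed (G i)) ->
  (forall i, G i setT) ->
  (forall A : I -> set T, (forall i, G i (A i)) ->
    P (\bigcap_(i in [set: I]) A i) = \prod_i P (A i)) ->
  forall A : I -> set T, (forall i, <<s G i >> (A i)) ->
    P (\bigcap_(i in [set: I]) A i) = \prod_i P (A i).
Proof.
move=> mG IG TG prodG.
have msG i : <<s G i >> `<=` measurable.
  by apply: smallest_sub => //; exact: sigma_algebra_measurable.
(* Here [r] lists the indices whose set already ranges over the generated sigma-algebra; all other
   sets still come from the pi-systems. *)
suff H (r : seq I) (A : I -> set T) :
    (forall i, <<s G i >> (A i)) -> (forall i, i \notin r -> G i (A i)) ->
    P (\bigcap_(i in [set: I]) A i) = \prod_i P (A i).
  by move=> A sA; apply: (H (enum I)) => // i; rewrite mem_enum.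
elim: r A => [A sA gA|k r IH A sA gA]; first by apply: prodG => i; exact: gA.
pose upd (X : set T) i := if i == k then X else A i.
pose B := \bigcap_(i in [set i | i != k]) A i.
have mB : measurable B.
  by apply: fin_bigcap_measurable => //; [exact: finite_finset|move=> i _; exact/msG].
have capE X : \bigcap_(i in [set: I]) upd X i = X `&` B.
  apply/seteqP; split => [w Hw|w [Xw Bw] i _].
    split; first by have := Hw k Logic.I; rewrite /upd eqxx.
    by move=> i /= ik; have := Hw i Logic.I; rewrite /upd (negbTE ik).
  by rewrite /upd; case: eqVneq => // ik; exact: Bw.
have prodE X : \prod_i P (upd X i) = P X * \prod_(i | i != k) P (A i).
  rewrite (bigD1 k)//= /upd eqxx; congr (_ * _).
  by apply: eq_bigr => i /negbTE ->.
have p_fin : \prod_(i | i != k) P (A i) \is a fin_num.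
  by apply: (big_ind (fun x : \bar R => x \is a fin_num)) => [//|x y|i _]; [exact: fin_numM|exact/fin_num_measure/msG].
have p_ge0 : (0 <= fine (\prod_(i | i != k) P (A i)))%R.
  by apply: fine_ge0; apply: (big_ind (fun x : \bar R => 0 <= x)) => // x y; exact: mule_ge0.
have updA : upd (A k) = A.
  by apply/funext => i; rewrite /upd; case: eqP => [->|].
rewrite -updA capE prodE.
have scaleE X : mscale (NngNum p_ge0) P X = P X * \prod_(i | i != k) P (A i).
  by rewrite /mscale /= fineK// muleC.
rewrite -scaleE -[LHS]/(mrestr P mB (A k)).
apply: (@g_sigma_algebra_measure_unique _ R T (G k) (mG k) (fun=> setT)
  (fun=> TG k) _ (mrestr P mB) (mscale (NngNum p_ge0) P) (IG k)) => //.
- by rewrite bigcup_const.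
- move=> X GX; rewrite [RHS]scaleE -prodE -[LHS]/(P (X `&` B)) -capE; apply: IH => i.
    by rewrite /upd; case: eqP => [->|_ //]; exact: sub_sigma_algebra.
  move=> ir; rewrite /upd; case: eqP => [->//|/eqP ik].
  by apply: gA; rewrite inE negb_or ik.
- move=> _; rewrite -[ltLHS]/(P (setT `&` B)) setTI -ge0_fin_numE//; exact: fin_num_measure.
Qed.

(** A pi-system generating the sigma-algebra of the variables in block [i], where [beta] assigns
    each variable to its block. *)
Definition block_rectangles {K I : finType} (X : K -> T -> R) (beta : K -> I)
    (i : I) : set (set T) :=
  [set A | exists2 B : K -> set R, (forall k, measurable (B k)) &
    A = \bigcap_(k in [set k | beta k = i]) (X k @^-1` B k)].

Lemma measurable_block_rectangles {K I : finType} (X : K -> T -> R)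
    (beta : K -> I) (k : K) :
  @measurable_fun _ _ (g_sigma_algebraType (block_rectangles X beta (beta k))) R
    setT (X k).
Proof.
move=> _ B mB; apply: sub_sigma_algebra; rewrite setTI.
exists (fun k' => if k' == k then B else setT).
  by move=> k'; case: ifP.
apply/seteqP; split => [w Bw k' _ /=|w /(_ k erefl)/=]; last by rewrite eqxx.
by case: eqP => [->|].
Qed.

(** Disjoint groups of independent variables are independent. On rectangles this is the hypothesis,
    with [setT] put at the coordinates outside the block; the sigma-algebras follow by the preceding
    extension. *)
Lemma product_rule_blocks (K I : finType) (X : K -> {RV P >-> R})
    (beta : K -> I) :
  (forall B : K -> set R, (forall k, measurable (B k)) ->
    P (\bigcap_(k in [set: K]) (X k @^-1` B k)) = \prod_k P (X k @^-1` B k)) ->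
  forall A : I -> set T,
    (forall i, <<s block_rectangles X beta i >> (A i)) ->
  P (\bigcap_(i in [set: I]) A i) = \prod_i P (A i).
Proof.
move=> indX; apply: product_rule_sigma_algebra => [i|i|i|A GA].
- move=> _ [B mB ->]; apply: fin_bigcap_measurable; first exact: finite_finset.
  by move=> k _; rewrite -[X in measurable X]setTI; exact: measurable_funPT.
- move=> _ _ [B mB ->] [C mC ->]; exists (fun k => B k `&` C k).
    by move=> k; exact: measurableI.
  apply/seteqP; split => [w [Bw Cw] k ki|w BCw].
    by split; [exact: Bw|exact: Cw].
  by split => k ki; have [] := BCw k ki.
- by exists (fun=> setT) => //; apply/seteqP.
- have /choice[B BP] : forall i, exists b : K -> set R,
      (forall k, measurable (b k)) /\
      A i = \bigcap_(k in [set k | beta k = i]) (X k @^-1` b k).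
    by move=> i; have [b] := GA i; exists b.
  have PA i : P (A i) = \prod_(k | beta k == i) P (X k @^-1` B i k).
    pose C k := if beta k == i then B i k else setT.
    have -> : A i = \bigcap_(k in [set: K]) (X k @^-1` C k).
      rewrite (BP i).2; apply/seteqP; split => w Hw k /=.
        by move=> _; rewrite /C; case: eqP => // ki; exact: Hw.
      by move=> ki; have := Hw k Logic.I; rewrite /C /= ki eqxx.
    rewrite indX; last by move=> k; rewrite /C; case: ifP => // _; exact: (BP i).1.
    rewrite [RHS]big_mkcond/=; apply: eq_bigr => k _; rewrite /C.
    by case: ifP => //; rewrite preimage_setT probability_setT.
  have -> : \bigcap_(i in [set: I]) A i =
      \bigcap_(k in [set: K]) (X k @^-1` B (beta k) k).
    apply/seteqP; split => w Hw.
      by move=> k _; have := Hw (beta k) Logic.I; rewrite (BP _).2 => /(_ k erefl).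
    by move=> i _; rewrite (BP i).2 => k /= <-; exact: Hw.
  rewrite indX; last by move=> k; exact: (BP _).1.
  rewrite (partition_big beta predT)//=; apply: eq_bigr => i _.
  by rewrite PA; apply: eq_bigr => k /eqP ->.
Qed.

Lemma integrable_bounded (f : T -> R) (C : R) :
  measurable_fun setT f -> (forall w, `|f w| <= C)%R ->
  P.-integrable setT (EFin \o f).
Proof.
move=> mf fC; apply: measurable_bounded_integrable => //.
  by rewrite -ge0_fin_numE//; exact: fin_num_measure.
by exists C; split; [exact: num_real|move=> M CM w _; exact: le_trans (fC w) (ltW CM)].
Qed.

End independence.

(** * Expectation of a product of independent variables *)

Section independent_pair.
Context {d : measure_display} {T : measurableType d} {R : realType}.
Variable P : probability T R.
Local Open Scope ereal_scope.

(** The joint law and the product of the marginal laws agree on rectangles, hence coincide;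
    boundedness of [f] and [g] then permits Fubini. *)
Lemma integralM_independent (X Y : {RV P >-> R}) (f g : R -> R) (C : R) :
  (forall A B, measurable A -> measurable B ->
    P (X @^-1` A `&` Y @^-1` B) = P (X @^-1` A) * P (Y @^-1` B)) ->
  measurable_fun setT f -> measurable_fun setT g ->
  (forall r, `|f r| <= C)%R -> (forall r, `|g r| <= C)%R ->
  \int[P]_w (f (X w) * g (Y w))%:E =
  (\int[P]_w (f (X w))%:E) * (\int[P]_w (g (Y w))%:E).
Proof.
move=> indXY mf mg fC gC.
have C0 : (0 <= C)%R by exact: le_trans (normr_ge0 _) (fC 0%R).
have mXY : measurable_fun setT (fun w => (X w, Y w)) by exact: measurable_fun_pair.
pose XYmixin := isMeasurableFun.Build _ _ _ _ _ mXY.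
pose XY : {mfun T >-> (R * R)%type} :=
  MeasurableFun.Pack (MeasurableFun.Class XYmixin).
pose h (z : R * R) := (f z.1 * g z.2)%:E.
have mh : measurable_fun [set: R * R] h.
  by apply/measurable_EFinP/measurable_funM; exact: measurableT_comp.
have -> : \int[P]_w (f (X w) * g (Y w))%:E = \int[distribution P XY]_z h z.
  rewrite integral_pushforward//.
  apply: (@integrable_bounded _ _ _ P (fun w => f (X w) * g (Y w))%R (C * C)%R).
    by apply: measurable_funM; exact: measurableT_comp.
  by move=> w; rewrite normrM ler_pM.
have <- : \int[distribution P X \x distribution P Y]_z h z =
    \int[distribution P XY]_z h z.
  apply: eq_measure_integral => A mA _.
  by apply: product_measure_unique => // B1 B2 mB1 mB2; exact: indXY.
rewrite -integral12_prod_meas1; last first.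
  apply: (@integrable_bounded _ _ _ _ (fun z => f z.1 * g z.2)%R (C * C)%R).
    by apply: measurable_funM; exact: measurableT_comp.
  by move=> w; rewrite normrM ler_pM.
have iY : (distribution P Y).-integrable setT (EFin \o g).
  exact: (integrable_bounded _ _ C).
have iX : (distribution P X).-integrable setT (EFin \o f).
  exact: (integrable_bounded _ _ C).
have gE : \int[P]_w (g (Y w))%:E = \int[distribution P Y]_y (g y)%:E.
  rewrite integral_pushforward//; first exact/measurable_EFinP.
  by apply: (@integrable_bounded _ _ _ P (g \o Y) C) => [|w]; [exact: measurableT_comp|exact: gC].
have fE : \int[P]_w (f (X w))%:E = \int[distribution P X]_y (f y)%:E.
  rewrite integral_pushforward//; first exact/measurable_EFinP.
  by apply: (@integrable_bounded _ _ _ P (f \o X) C) => [|w]; [exact: measurableT_comp|exact: fC].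
rewrite gE fE.
have fing : \int[distribution P Y]_y (g y)%:E \is a fin_num.
  exact: integrable_fin_num.
transitivity (\int[distribution P X]_x ((f x)%:E * (\int[distribution P Y]_y (g y)%:E))).
  apply: eq_integral => x _; rewrite /fubini_F /h/=.
  by rewrite -integralZl//; under eq_integral do rewrite EFinM.
by rewrite -(fineK fing) integralZr.
Qed.

Lemma integralM_independent_fun (X Y : T -> R) (f g : R -> R) (C : R) :
  measurable_fun setT X -> measurable_fun setT Y ->
  (forall A B, measurable A -> measurable B ->
    P (X @^-1` A `&` Y @^-1` B) = P (X @^-1` A) * P (Y @^-1` B)) ->
  measurable_fun setT f -> measurable_fun setT g ->
  (forall r, `|f r| <= C)%R -> (forall r, `|g r| <= C)%R ->
  \int[P]_w (f (X w) * g (Y w))%:E =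
  (\int[P]_w (f (X w))%:E) * (\int[P]_w (g (Y w))%:E).
Proof.
move=> mX mY.
pose X' : {RV P >-> R} :=
  MeasurableFun.Pack (MeasurableFun.Class (isMeasurableFun.Build _ _ _ _ _ mX)).
pose Y' : {RV P >-> R} :=
  MeasurableFun.Pack (MeasurableFun.Class (isMeasurableFun.Build _ _ _ _ _ mY)).
exact: (integralM_independent X' Y').
Qed.

End independent_pair.

(** * Comparison of integrals and Fubini *)

Section integral_tools.
Context {d : measure_display} {T : measurableType d} {R : realType}.
Local Open Scope ereal_scope.

(** The integral is a difference of suprema over simple functions; passing from [f] to [g] enlarges
    the positive part and shrinks the negative one. Measurability never enters, which spares a check
    at each comparison below. *)
Lemma le_integral_pointwise (mu : {measure set T -> \bar R}) (D : set T)
    (f g : T -> \bar R) : (forall x, D x -> f x <= g x) ->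
  \int[mu]_(x in D) f x <= \int[mu]_(x in D) g x.
Proof.
move=> fg; rewrite /integral.
have fgD x : (f \_ D) x <= (g \_ D) x.
  by rewrite !patchE; case: ifPn => // /set_mem; exact: fg.
apply: leeB; apply: ereal_sup_le => _ [s sh <-]; exists s => // x;
  rewrite (le_trans (sh x))// ?funeposE ?funenegE ge_max !le_max lexx orbT andbT.
  by rewrite fgD.
by rewrite leeN2 fgD.
Qed.

End integral_tools.

Section Fubini_probability.
Context {d : measure_display} {T : measurableType d} {R : realType}.
Local Open Scope ereal_scope.

(** Since P has mass one, a bound on the inner absolute integrals that is uniform in [w] makes the
    integrand integrable on the product. *)
Lemma Fubini_probability (P : probability T R) (D : set R) (h : T * R -> R)
    (C : R) :
  measurable D -> measurable_fun setT h ->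
  (forall w, \int[lebesgue_measure]_(t in D) `|h (w, t)|%:E <= C%:E) ->
  \int[P]_w \int[lebesgue_measure]_(t in D) (h (w, t))%:E =
  \int[lebesgue_measure]_(t in D) \int[P]_w (h (w, t))%:E.
Proof.
move=> mD mh hC.
pose f (z : T * R) := (h z * \1_D z.2)%:E.
have mf : measurable_fun setT f.
  apply/measurable_EFinP/measurable_funM => //.
  by apply: measurableT_comp => //.
have patchf w : (fun t => (h (w, t))%:E) \_ D = (fun t => f (w, t)).
  apply/funext => t; rewrite patchE /f indicE.
  by case: ifP => _; rewrite /= ?mulr1 ?mulr0.
have intf : (P \x (@lebesgue_measure R)).-integrable setT f.
  apply/integrable12ltyP; first exact: mf.
  apply: (@le_lt_trans _ _ (\int[P]_w C%:E)).
    apply: le_integral_pointwise => w _.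
    rewrite (le_trans _ (hC w))// [leRHS]integral_mkcond.
    apply: le_integral_pointwise => t _; rewrite patchE /f indicE.
    by case: ifP => _; rewrite /= ?mulr1 ?mulr0 ?normr0.
  by rewrite integral_cst// [X in _ * X]probability_setT mule1 ltry.
under eq_integral do rewrite integral_mkcond patchf.
rewrite (Fubini intf) [RHS]integral_mkcond; apply: eq_integral => t _.
rewrite patchE /f /=; case: ifPn => tD.
  by apply: eq_integral => w _; rewrite indicE tD mulr1.
under eq_integral do rewrite indicE (negbTE tD) mulr0.
exact: integral0.
Qed.

End Fubini_probability.

(** * The fundamental theorem of calculus on open and unbounded intervals *)

Section FTC_corollaries.
Context {R : realType}.
Local Open Scope ereal_scope.
Let mu := @lebesgue_measure R.

Lemma is_derive_continuous (F : R -> R) (x df : R) :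
  is_derive x 1%R F df -> {for x, continuous F}.
Proof.
move=> [dF _]; apply: differentiable_continuous.
exact/derivable1_diffP.
Qed.

Lemma ge0_integral_0y (f F : R -> R) (l : R) :
  (forall x : R, (0 <= x)%R -> (0 <= f x)%R) -> continuous f ->
  (forall x : R, is_derive x (1 : R)%R F (f x)) -> F x @[x --> +oo%R] --> l ->
  \int[mu]_(x in `]0%R, +oo[) (f x)%:E = (l - F 0%R)%:E.
Proof.
move=> f0 cf dF Fl.
rewrite integral_itv_obnd_cbnd//; last first.
  by apply/measurable_EFinP/measurable_funTS; exact: continuous_measurable_fun.
rewrite (ge0_continuous_FTC2y f0 _ Fl)//.
- exact: continuous_subspaceT.
- by apply: cvg_at_right_filter; exact: is_derive_continuous (dF _).
- by move=> x _; rewrite derive1E; have [_ ->] := dF x.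
Qed.

(** The fundamental theorem on each compact piece, then monotone convergence. Bounding all
    increments of the primitive by [L] replaces the computation of its limits at the ends of [D]. *)
Lemma ge0_integral_exhaustion_le (f F : R -> R) (D : set R) (u v : R^nat)
    (L : R) :
  (forall n, u n < v n)%R -> {homo u : m n / (m <= n)%N >-> (n <= m)%R} ->
  {homo v : m n / (m <= n)%N >-> (m <= n)%R} ->
  D = \bigcup_n `[u n, v n]%classic ->
  (forall x : R, D x -> (0 <= f x)%R) ->
  (forall x : R, D x -> {for x, continuous f}) ->
  (forall x : R, D x -> derivable F x 1%R /\ 'D_1 F x = f x) ->
  (forall x y, D x -> D y -> (x < y)%R -> (F y - F x <= L)%R) ->
  \int[mu]_(x in D) (f x)%:E <= L%:E.
Proof.
move=> uv ndu ndv DE f0 cf dF FL.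
pose A n : set R := `[u n, v n]%classic.
have subA n x : A n x -> D x by move=> ?; rewrite DE; exists n.
have mf n : measurable_fun (A n) (EFin \o f).
  apply/measurable_EFinP.
  apply: subspace_continuous_measurable_fun => //; first exact: measurable_itv.
  by apply: (@continuous_in_subspaceT R R) => x /set_mem /subA; exact: cf.
have int_le n : \int[mu]_(x in A n) (f x)%:E <= L%:E.
  have inA x : x \in `](u n), (v n)[ -> D x.
    move=> xuv; apply: (subA n); exact: subset_itv_oo_cc xuv.
  have Du : D (u n) by apply: (subA n); rewrite /A/= in_itv/= lexx ltW.
  have Dv : D (v n) by apply: (subA n); rewrite /A/= in_itv/= lexx ltW.
  rewrite /A (@continuous_FTC2 _ f F)//.
  - by rewrite -EFinB lee_fin; exact: FL.
  - by apply: continuous_in_subspaceT => x /set_mem /(@subA n); exact: cf.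
  - split.
    + by move=> x /inA ax; have [] := dF x ax.
    + by apply: cvg_at_right_filter; exact/differentiable_continuous/derivable1_diffP/(dF _ Du).1.
    + by apply: cvg_at_left_filter; exact/differentiable_continuous/derivable1_diffP/(dF _ Dv).1.
  - by move=> x /inA ax; rewrite derive1E; have [_ ->] := dF x ax.
rewrite DE -/A.
have ndA : nondecreasing_seq A.
  move=> m n mn; apply/subsetPset => x; rewrite /A/= !in_itv/=.
  by move=> /andP[ux xv]; rewrite (le_trans (ndu _ _ mn))// (le_trans xv)// ndv.
have mA n : measurable (A n) by exact: measurable_itv.
have fA0 n x : A n x -> 0 <= (EFin \o f) x.
  by move=> /subA Dx; rewrite lee_fin; exact: f0.
have := @ge0_nondecreasing_set_cvg_integral _ (measurableTypeR R) R A (EFin \o f)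
  (@lebesgue_measure R) ndA mA mf fA0.
move=> /cvge_to_le; apply.
by apply: nearW.
Qed.

Lemma ge0_integral_oy_le (f F : R -> R) (a L : R) :
  (forall x, (a < x)%R -> (0 <= f x)%R) ->
  (forall x, (a < x)%R -> {for x, continuous f}) ->
  (forall x : R, (a < x)%R -> derivable F x 1%R /\ 'D_1 F x = f x) ->
  (forall x y, (a < x)%R -> (x < y)%R -> (F y - F x <= L)%R) ->
  \int[mu]_(x in `]a, +oo[) (f x)%:E <= L%:E.
Proof.
move=> f0 cf dF FL.
have inD x : `]a, +oo[%classic x = (a < x)%R :> Prop.
  by rewrite /= in_itv/= andbT.
(* The pieces are nondegenerate from n = 0 on, because 1 / (n + 1) <= 1 < n + 2. *)
apply: (@ge0_integral_exhaustion_le f F _ (fun n => a + n.+1%:R^-1)%R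
    (fun n => a + n.+2%:R)%R) => [n|m n mn|m n mn||x|x|x|x y].
- rewrite ltrD2l (@le_lt_trans _ _ 1%R) ?ltr1n//.
  by rewrite invf_le1 ?ltr0n// ler1n.
- by rewrite lerD2l lef_pV2 ?posrE ?ltr0n// ler_nat ltnS.
- by rewrite lerD2l ler_nat !ltnS.
- apply/seteqP; split => [x|x [n _ ]]; rewrite inD; last first.
    rewrite /= in_itv/= => /andP[+ _]; apply: lt_le_trans.
    by rewrite ltrDl invr_gt0 ltr0n.
  move=> ax; have xa0 : (0 < x - a)%R by rewrite subr_gt0.
  pose n := maxn (Num.truncn (x - a)^-1) (Num.truncn (x - a)).
  exists n => //=; rewrite in_itv/=; apply/andP; split.
    rewrite -lerBrDl -[leRHS]invrK lef_pV2 ?posrE ?ltr0n ?invr_gt0//.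
    by rewrite (le_trans (ltW (truncnS_gt _)))// ler_nat ltnS leq_maxl.
  rewrite -lerBlDl (le_trans (ltW (truncnS_gt _)))// ler_nat ltnS.
  by apply: leq_trans (leqnSn _); exact: leq_maxr.
- by rewrite inD; exact: f0.
- by rewrite inD; exact: cf.
- by rewrite inD; exact: dF.
- by rewrite !inD => ax _; exact: FL.
Qed.

Lemma ge0_integral_oo_le (f F : R -> R) (a b L : R) : (a < b)%R ->
  (forall x, (a < x < b)%R -> (0 <= f x)%R) ->
  (forall x, (a < x < b)%R -> {for x, continuous f}) ->
  (forall x : R, (a < x < b)%R -> derivable F x 1%R /\ 'D_1 F x = f x) ->
  (forall x y, (a < x)%R -> (x < y)%R -> (y < b)%R -> (F y - F x <= L)%R) ->
  \int[mu]_(x in `]a, b[) (f x)%:E <= L%:E.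
Proof.
move=> ab f0 cf dF FL.
have inD x : `]a, b[%classic x = (a < x < b)%R :> Prop by rewrite /= in_itv.
(* With the denominator n + 3 the margins satisfy 2 e n < b - a already for n = 0. *)
pose e n : R := ((b - a) / n.+3%:R)%R.
have ba0 : (0 < b - a)%R by rewrite subr_gt0.
have e0 n : (0 < e n)%R by rewrite divr_gt0// ltr0n.
have nde m n : (m <= n)%N -> (e n <= e m)%R.
  by move=> mn; rewrite ler_pM2l// lef_pV2 ?posrE ?ltr0n// ler_nat !ltnS.
have e_lt n : (e n + e n < b - a)%R.
  rewrite -mulr2n -mulr_natr -mulrA gtr_pMr// mulrC ltr_pdivrMr ?ltr0n//.
  by rewrite mul1r ltr_nat.
apply: (@ge0_integral_exhaustion_le f F _ (fun n => a + e n)%R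
    (fun n => b - e n)%R) => [n|m n mn|m n mn||x|x|x|x y].
- by have := e_lt n; lra.
- by rewrite lerD2l nde.
- by rewrite lerD2l lerN2 nde.
- apply/seteqP; split => [x|x [n _ ]]; rewrite inD; last first.
    by have := e0 n; rewrite /= in_itv/= => en /andP[? ?]; apply/andP; split; lra.
  move=> /andP[ax xb]; pose m := (Num.min (x - a) (b - x) / (b - a))%R.
  have m0 : (0 < m)%R by rewrite divr_gt0// lt_min !subr_gt0 ax.
  pose n := Num.truncn m^-1.
  have em : (e n <= m * (b - a))%R.
    rewrite /e mulrC ler_pM2r// -[leRHS]invrK lef_pV2 ?posrE ?ltr0n ?invr_gt0//.
    by rewrite (le_trans (ltW (truncnS_gt _)))// ler_nat -/n ltnS (leq_trans (leqnSn _)).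
  move: em; rewrite /m divfK ?gt_eqF// le_min => /andP[? ?].
  by exists n => //=; rewrite in_itv/=; apply/andP; split; lra.
- by rewrite inD; exact: f0.
- by rewrite inD; exact: cf.
- by rewrite inD; exact: dF.
- by rewrite !inD => /andP[ax _] /andP[_ yb] xy; exact: FL.
Qed.

End FTC_corollaries.

(** * Laplace and Cauchy integrals *)

Section laplace.
Context {R : realType}.
Local Open Scope ereal_scope.
Let mu := @lebesgue_measure R.

Lemma is_derive_expRNM (a t : R) :
  is_derive t (1 : R)%R (fun t => expR (- (a * t)))%R (- a * expR (- (a * t)))%R.
Proof.
by apply: is_derive_eq; rewrite /GRing.scale/=; ring.
Qed.

Lemma cvg_expRNM (a : R) : (0 < a)%R -> (expR (- (a * t)))%R @[t --> +oo%R] --> 0%R.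
Proof.
move=> a0; apply: (@cvg_comp _ _ _ (fun t => a * t)%R (fun t => expR (- t)) _ +oo%R).
  exact: gt0_cvgMry.
exact: cvgr_expR.
Qed.

Lemma cvg_bounded_expRNM (a K : R) (g : R -> R) : (0 < a)%R ->
  (forall t, `|g t| <= K)%R ->
  (expR (- (a * t)) * g t)%R @[t --> +oo%R] --> 0%R.
Proof.
move=> a0 gK; apply/norm_cvg0P.
apply: (@squeeze_cvgr _ _ _ _ (cst 0%R) (fun t => expR (- (a * t)) * K)%R).
- by apply: nearW => t; rewrite /= normr_ge0/= normrM ger0_norm ?expR_ge0// ler_pM2l// expR_gt0.
- exact: cvg_cst.
- by rewrite -[X in _ --> X](mul0r K); apply: cvgM; [exact: cvg_expRNM|exact: cvg_cst].
Qed.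

Lemma continuous_expRNM (a : R) : continuous (fun t : R => expR (- (a * t)))%R.
Proof. by move=> t; exact: is_derive_continuous (is_derive_expRNM a t). Qed.

Lemma integral_expRNM (a : R) : (0 < a)%R ->
  \int[mu]_(t in `]0%R, +oo[) (expR (- (a * t)))%:E = (a^-1)%:E.
Proof.
move=> a0; pose F t : R := (- a^-1 * expR (- (a * t)))%R.
have -> : (a^-1 = 0 - F 0)%R by rewrite /F mulr0 oppr0 expR0 mulr1 opprK add0r.
apply: ge0_integral_0y.
- by move=> t _; exact: expR_ge0.
- exact: continuous_expRNM.
- move=> t; rewrite /F; apply: is_derive_eq; rewrite /GRing.scale/=; field.
  by rewrite gt_eqF.
- by rewrite /F -[X in _ --> X](mulr0 (- a^-1)%R); apply: cvgM; [exact: cvg_cst|exact: cvg_expRNM].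
Qed.

Lemma integrable_expRNM_bounded (a K : R) (g : R -> R) : (0 < a)%R ->
  measurable_fun setT g -> (forall t, `|g t| <= K)%R ->
  mu.-integrable `]0%R, +oo[ (fun t => (expR (- (a * t)) * g t)%:E).
Proof.
move=> a0 mg gK.
have K0 : (0 <= K)%R by exact: le_trans (normr_ge0 _) (gK 0%R).
have me : measurable_fun [set: R] (fun t : R => expR (- (a * t)))%R.
  by apply: continuous_measurable_fun; exact: continuous_expRNM.
apply/integrableP; split.
  by apply/measurable_EFinP/measurable_funTS/measurable_funM.
apply: (@le_lt_trans _ _ (\int[mu]_(t in `]0%R, +oo[) (K%:E * (expR (- (a * t)))%:E))).
  apply: le_integral_pointwise => t _; rewrite -EFinM lee_fin normrM mulrC.
  by rewrite (ger0_norm (expR_ge0 _)) ler_pM2r ?expR_gt0.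
rewrite ge0_integralZl_EFin//.
- by rewrite integral_expRNM// -EFinM ltry.
- exact/measurable_EFinP/measurable_funTS.
Qed.

(** The fundamental theorem above wants a nonnegative integrand, so 1 + sin is integrated in place
    of sin, and the integral of the pure exponential is subtracted afterwards. *)
Lemma integral_expRNM_sin (a y : R) : (0 < a)%R ->
  \int[mu]_(t in `]0%R, +oo[) (expR (- (a * t)) * sin (t * y))%:E =
  (y / (a ^+ 2 + y ^+ 2))%:E.
Proof.
move=> a0.
have ay : (a ^+ 2 + y ^+ 2 != 0)%R by rewrite gt_eqF// ltr_wpDr ?sqr_ge0// exprn_gt0.
have dsin (t : R) : is_derive t (1 : R)%R (fun t => sin (t * y))%R (y * cos (t * y))%R.
  by apply: is_derive_eq; rewrite /GRing.scale/=; ring.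
have dcos (t : R) : is_derive t (1 : R)%R (fun t => cos (t * y))%R (- (y * sin (t * y)))%R.
  by apply: is_derive_eq; rewrite /GRing.scale/=; ring.
have csin : continuous (fun t : R => sin (t * y))%R.
  by move=> t; exact: is_derive_continuous (dsin t).
pose G t : R := (- a^-1 - (a * sin (t * y) + y * cos (t * y)) / (a ^+ 2 + y ^+ 2))%R.
have int1 : \int[mu]_(t in `]0%R, +oo[) (expR (- (a * t)) * (1 + sin (t * y)))%:E =
    (a^-1 + y / (a ^+ 2 + y ^+ 2))%:E.
  pose F t : R := (expR (- (a * t)) * G t)%R.
  have -> : (a^-1 + y / (a ^+ 2 + y ^+ 2) = 0 - F 0)%R.
    rewrite /F /G mulr0 mul0r sin0 cos0 oppr0 expR0.
    by field; rewrite ay gt_eqF.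
  apply: ge0_integral_0y.
  - by move=> t _; rewrite mulr_ge0 ?expR_ge0//; have := sin_geN1 (t * y)%R; lra.
  - move=> t; apply: cvgM; first exact: continuous_expRNM.
    by apply: cvgD; [exact: cvg_cst|exact: csin].
  - move=> t; rewrite /F /G; apply: is_derive_eq; rewrite /GRing.scale/=; field.
    by rewrite ay gt_eqF.
  - apply: (@cvg_bounded_expRNM _ (a^-1 + (a + `|y|) / (a ^+ 2 + y ^+ 2))%R) => // t.
    rewrite /G (le_trans (ler_normB _ _))// normrN (ger0_norm (ltW _)) ?invr_gt0//.
    rewrite lerD2l normrM normfV [X in (_ / X)%R]ger0_norm ?addr_ge0 ?sqr_ge0//.
    rewrite ler_wpM2r ?invr_ge0 ?addr_ge0 ?sqr_ge0//.
    rewrite (le_trans (ler_normD _ _))// !normrM (gtr0_norm a0) lerD//.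
      by rewrite ler_piMr ?sin_max// ltW.
    by rewrite ler_piMr ?cos_max.
have ie := @integrable_expRNM_bounded a 1%R (cst 1%R) a0 (measurable_cst _) _.
have is1 := @integrable_expRNM_bounded a 1%R (fun t => sin (t * y))%R a0
  (continuous_measurable_fun csin) (fun t => sin_max _).
have : \int[mu]_(t in `]0%R, +oo[) ((expR (- (a * t)) * 1)%:E + (expR (- (a * t)) * sin (t * y))%:E) =
    (a^-1 + y / (a ^+ 2 + y ^+ 2))%:E.
  by rewrite -int1; apply: eq_integral => t _; rewrite -EFinD mulrDr.
rewrite integralD//=; last by apply: ie => t; rewrite normr1.
under [X in X + _ = _]eq_integral do rewrite mulr1.
rewrite integral_expRNM//.
have := integrable_fin_num _ is1; rewrite /= => /(_ (measurable_itv _)) fs.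
by rewrite -(fineK fs) -EFinD => -[] /addrI ->.
Qed.

Lemma integral_cauchy (y : R) :
  \int[mu]_(a in `]0%R, +oo[) (y / (a ^+ 2 + y ^+ 2))%:E = (pi / 2 * Num.sg y)%:E.
Proof.
have pos (z : R) : (0 < z)%R ->
    \int[mu]_(a in `]0%R, +oo[) (z / (a ^+ 2 + z ^+ 2))%:E = (pi / 2)%:E.
  move=> z0.
  have nz (a : R) : (a ^+ 2 + z ^+ 2 != 0)%R.
    by rewrite gt_eqF// ltr_wpDl ?sqr_ge0// exprn_gt0.
  pose F a : R := atan (a / z)%R.
  have -> : (pi / 2 = pi / 2 - F 0)%R by rewrite /F mul0r atan0 subr0.
  apply: ge0_integral_0y.
  - by move=> a _; rewrite divr_ge0 ?addr_ge0 ?sqr_ge0// ltW.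
  - move=> a; apply: cvgM; first exact: cvg_cst.
    apply: cvgV; first exact: nz.
    by apply: cvgD; [exact: exprn_continuous|exact: cvg_cst].
  - move=> a; rewrite /F; apply: is_derive_eq; rewrite /GRing.scale/=; field.
    by rewrite nz gt_eqF.
  - apply: (@cvg_comp _ _ _ (fun a => a / z)%R atan _ +oo%R).
      by apply: gt0_cvgMly; rewrite ?invr_gt0.
    exact: cvgy_atan.
case: (ltgtP y 0%R) => [y0|y0|->].
- rewrite ltr0_sg// mulrN1 EFinN -(pos (- y)%R) ?oppr_gt0//.
  rewrite -integral_ge0N; last first.
    move=> a _; rewrite lee_fin divr_ge0 ?addr_ge0 ?sqr_ge0//; lra.
  by apply: eq_integral => a _; rewrite -EFinN sqrrN mulNr opprK.
- by rewrite gtr0_sg// mulr1 pos.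
- rewrite sgr0 mulr0; apply: integral0_eq => a _; by rewrite mul0r.
Qed.

(** Tonelli, since e^(- a t) integrates to 1 / t over a > 0. Both sides may be infinite. *)
Lemma integral_Laplace_div (F : R -> R) : measurable_fun setT F ->
  (forall t, (0 < t)%R -> (0 <= F t)%R) ->
  \int[mu]_(a in `]0%R, +oo[) \int[mu]_(t in `]0%R, +oo[) (expR (- (a * t)) * F t)%:E =
  \int[mu]_(t in `]0%R, +oo[) (F t / t)%:E.
Proof.
move=> mF F0.
pose D : set R := `]0%R, +oo[%classic.
pose f (z : R * R) := (expR (- (z.1 * z.2)) * (F z.2 * \1_D z.2) * \1_D z.1)%:E.
have m1D : measurable_fun [set: R] (\1_D : R -> R).
  by apply: measurable_indic; exact: measurable_itv.
have mD : measurable D by exact: measurable_itv.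
have mf : measurable_fun setT f.
  apply/measurable_EFinP/measurable_funM; last exact: measurableT_comp.
  apply: measurable_funM.
    apply: measurableT_comp => //; apply: measurableT_comp => //.
    exact: measurable_funM.
  by apply: measurable_funM; exact: measurableT_comp.
have f0 z : 0 <= f z.
  rewrite lee_fin mulr_ge0// mulr_ge0 ?expR_ge0// indicE.
  by case: (boolP (z.2 \in D)) => [/set_mem|]; rewrite ?mulr0// mulr1 /D/= in_itv/= andbT => /F0.
transitivity (\int[mu]_a \int[mu]_t f (a, t)).
  rewrite [LHS]integral_mkcond; apply: eq_integral => a _.
  rewrite patchE -/D; case: ifPn => aD.
    rewrite integral_mkcond; apply: eq_integral => t _.
    rewrite patchE /f /= !indicE aD -/D.
    by case: ifP => _; rewrite ?mulr0 ?mulr1 ?mul0r.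
  by rewrite integral0_eq// => t _; rewrite /f /= !indicE (negbTE aD) mulr0.
rewrite fubini_tonelli//= [RHS]integral_mkcond; apply: eq_integral => t _.
rewrite patchE /f /= -/D; under eq_integral do rewrite !indicE.
case: ifPn => tD; last first.
  by apply: integral0_eq => a _; rewrite /= mulr0 mulr0 mul0r.
have t0 : (0 < t)%R by move/set_mem: tD; rewrite /D/= in_itv/= andbT.
transitivity (\int[mu]_(a in D) ((F t)%:E * (expR (- (t * a)))%:E)).
  rewrite [RHS]integral_mkcond; apply: eq_integral => a _.
  rewrite patchE mulr1; case: ifP => _; last by rewrite mulr0.
  by rewrite mulr1 -EFinM mulrC (mulrC t).
rewrite ge0_integralZl_EFin//; last 2 first.
- apply/measurable_EFinP/measurable_funTS.
  by apply: continuous_measurable_fun; exact: continuous_expRNM.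
- exact: (F0 _ t0).
by rewrite integral_expRNM// -EFinM.
Qed.

End laplace.

(** * Measurability and integrability of the Cauchy kernel *)

Section sign_transform.
Context {R : realType}.
Local Open Scope ereal_scope.
Let mu := @lebesgue_measure R.

Lemma measurable_sgr : measurable_fun [set: R] (@Num.sg R).
Proof.
have -> : @Num.sg R = (fun x => if x == 0 then 0 else if x < 0 then -1 else 1)%R.
  by apply/funext => x; case: ltgtP => [/ltr0_sg|/gtr0_sg|->//]; rewrite ?sgr0.
apply: measurable_fun_ifT => //; first exact: measurable_fun_eqr.
by apply: measurable_fun_ifT => //; exact: measurable_fun_ltr.
Qed.

(** The inverse of the denominator is written as its real power -1, whose measurability in the base
    is known; the base is nonnegative, and at 0 both expressions are 0. *)
Lemma measurable_cauchy :
  measurable_fun [set: R * R] (fun z : R * R => z.2 / (z.1 ^+ 2 + z.2 ^+ 2))%R.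
Proof.
have -> : (fun z : R * R => z.2 / (z.1 ^+ 2 + z.2 ^+ 2))%R =
    (fun z : R * R => z.2 * (z.1 ^+ 2 + z.2 ^+ 2) `^ (-1))%R.
  by apply/funext => z; rewrite powR_inv1// addr_ge0 ?sqr_ge0.
apply: measurable_funM => //.
apply: (measurableT_comp (measurable_powR (-1)%R)) => //.
by apply: measurable_funD; exact: measurable_funX.
Qed.

Lemma measurable_invr : measurable_fun [set: R] (fun x : R => x^-1)%R.
Proof.
rewrite (_ : (fun x => _) = (fun z : R * R => z.2 / (z.1 ^+ 2 + z.2 ^+ 2))%R \o
    (fun x : R => (0, x)%R)); last first.
  apply/funext => x /=; rewrite expr0n/= add0r.
  have [->|x0] := eqVneq x 0%R; first by rewrite mul0r invr0.
  by rewrite expr2 invfM mulrA mulfV// mul1r.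
by apply: (measurableT_comp measurable_cauchy); exact: measurable_fun_pair.
Qed.

Lemma integral_abs_cauchy_le (y : R) :
  \int[mu]_(a in `]0%R, +oo[) `|y / (a ^+ 2 + y ^+ 2)|%:E <= (pi / 2)%:E.
Proof.
rewrite (_ : \int[mu]_(_ in _) _ = (pi / 2 * Num.sg `|y|)%:E); last first.
  rewrite -integral_cauchy; apply: eq_integral => a _; congr EFin.
  rewrite normrM normfV real_normK ?num_real//; congr (_ / _)%R.
  by rewrite ger0_norm// addr_ge0 ?sqr_ge0.
rewrite lee_fin ler_piMr ?divr_ge0 ?pi_ge0//.
by have [->|y0] := eqVneq y 0%R; rewrite ?normr0 ?sgr0// gtr0_sg// normr_gt0.
Qed.

Lemma integrable_cauchy (y : R) :
  mu.-integrable `]0%R, +oo[ (fun a => (y / (a ^+ 2 + y ^+ 2))%:E).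
Proof.
apply/integrableP; split.
  apply/measurable_EFinP/measurable_funTS.
  apply: (measurableT_comp (g := fun a : R => (a, y)) measurable_cauchy).
  exact: measurable_fun_pair.
exact: le_lt_trans (integral_abs_cauchy_le y) (ltry _).
Qed.

Lemma integralZB_EFin (D : set R) (u v : R -> R) (a b c : R) : measurable D ->
  mu.-integrable D (EFin \o u) -> mu.-integrable D (EFin \o v) ->
  \int[mu]_(t in D) (u t)%:E = a%:E -> \int[mu]_(t in D) (v t)%:E = b%:E ->
  \int[mu]_(t in D) (c * (u t - v t))%:E = (c * (a - b))%:E.
Proof.
move=> mD iu iv ua vb.
under eq_integral do rewrite EFinM EFinB.
rewrite integralZl//; last exact: integrableB.
by rewrite integralB_EFin// ua vb.
Qed.

End sign_transform.

(** * Signs expressed through expectations of sines *)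

Section sign_expectation.
Context {d : measure_display} {T : measurableType d} {R : realType}.
Variable P : probability T R.
Local Open Scope ereal_scope.
Let mu := @lebesgue_measure R.

(** Used twice: with weight sg S for the signs of S - Z / b and S - Z / c, and with weight sin (t S)
    and Y = 0 for sg S itself. The two exchanges with the expectation are dominated by a pair of
    Cauchy kernels of integral at most pi / 2 each, and by 2 e^(- a t) for fixed a > 0. *)
Lemma expectation_sgB (g X Y : T -> R) (N : R -> R) :
  measurable_fun setT g -> measurable_fun setT X -> measurable_fun setT Y ->
  (forall w, `|g w| <= 1)%R ->
  (forall t, (0 < t)%R ->
    \int[P]_w (g w * (sin (t * X w) - sin (t * Y w)))%:E = (N t)%:E) ->
  (pi / 2)%:E * \int[P]_w (g w * (Num.sg (X w) - Num.sg (Y w)))%:E =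
  \int[mu]_(a in `]0%R, +oo[) \int[mu]_(t in `]0%R, +oo[)
    (expR (- (a * t)) * N t)%:E.
Proof.
move=> mg mX mY g1 EN.
have mD : measurable (`]0%R, +oo[%classic : set R) by exact: measurable_itv.
have gM w (u v x y : R) : (`|u| <= x -> `|v| <= y -> `|g w * (u - v)| <= x + y)%R.
  move=> ux vy; rewrite normrM (le_trans (ler_piMl _ (g1 w)))//.
  by rewrite (le_trans (ler_normB _ _))// lerD.
(* [h1 a] is the integrand after both transforms and [h2] after the first only; integrating [h1 a]
   over t > 0 gives back [h2] at [a]. *)
pose h1 (a : R) (z : T * R) := (expR (- (a * z.2)) *
  (g z.1 * (sin (z.2 * X z.1) - sin (z.2 * Y z.1))))%R.
pose k (a y : R) := (y / (a ^+ 2 + y ^+ 2))%R.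
pose h2 (z : T * R) := (g z.1 * (k z.2 (X z.1) - k z.2 (Y z.1)))%R.
have msin : measurable_fun [set: R] (@sin R).
  by apply: continuous_measurable_fun; exact: continuous_sin.
have m1 (f : T -> R) : measurable_fun setT f ->
    measurable_fun [set: T * R] (fun z : T * R => f z.1).
  by move=> mf; exact: measurableT_comp.
have mexp (a : R) : measurable_fun [set: R] (fun t : R => expR (- (a * t)))%R.
  by apply: continuous_measurable_fun; exact: continuous_expRNM.
have mh1 a : measurable_fun setT (h1 a).
  apply: measurable_funM; first exact: (measurableT_comp (mexp a)).
  apply: measurable_funM; first exact: m1.
  by apply: measurable_funB; apply: measurableT_comp => //;
    apply: measurable_funM => //; exact: m1.
have mh2 : measurable_fun setT h2.
  apply: measurable_funM; first exact: m1.
  have mk (f : T -> R) : measurable_fun setT f ->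
      measurable_fun [set: T * R] (fun z : T * R => k z.2 (f z.1)).
    move=> mf; apply: (measurableT_comp (g := fun z : T * R => (z.2, f z.1))
      measurable_cauchy).
    by apply: measurable_fun_pair => //; exact: m1.
  by apply: measurable_funB; exact: mk.
have h1_int w a : (0 < a)%R -> \int[mu]_(t in `]0%R, +oo[) (h1 a (w, t))%:E =
    (h2 (w, a))%:E.
  move=> a0; have isin y : mu.-integrable `]0%R, +oo[
      (EFin \o (fun t => expR (- (a * t)) * sin (t * y)))%R.
    apply: (@integrable_expRNM_bounded _ _ 1%R) => //.
      by apply: measurableT_comp => //; exact: measurable_funM.
    by move=> t; exact: sin_max.
  rewrite -(integralZB_EFin _ _ _ _ _ _ mD (isin (X w)) (isin (Y w))
    (integral_expRNM_sin _ _ a0) (integral_expRNM_sin _ _ a0)).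
  by apply: eq_integral => t _; rewrite /h1/=; congr EFin; ring.
have h2_int w : \int[mu]_(a in `]0%R, +oo[) (h2 (w, a))%:E =
    (g w * (pi / 2 * Num.sg (X w) - pi / 2 * Num.sg (Y w)))%:E.
  exact: (integralZB_EFin _ (k^~ (X w)) (k^~ (Y w)) _ _ (g w) mD
    (integrable_cauchy _) (integrable_cauchy _) (integral_cauchy _)
    (integral_cauchy _)).
have -> : (pi / 2)%:E * \int[P]_w (g w * (Num.sg (X w) - Num.sg (Y w)))%:E =
    \int[P]_w \int[mu]_(a in `]0%R, +oo[) (h2 (w, a))%:E.
  rewrite -integralZl//; last first.
    apply: (@integrable_bounded _ _ _ P _ (1 + 1)%R).
      by apply: measurable_funM => //; apply: measurable_funB;
        apply: (measurableT_comp measurable_sgr).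
    by move=> w; apply: gM; rewrite normr_sg; case: (_ != _); rewrite ?ler01.
  by apply: eq_integral => w _; rewrite h2_int -EFinM; congr EFin; ring.
rewrite (@Fubini_probability _ _ _ _ _ _ (pi / 2 + pi / 2)%R)//; last first.
  move=> w; rewrite EFinD (le_trans _ (leeD (integral_abs_cauchy_le (X w))
    (integral_abs_cauchy_le (Y w))))//.
  rewrite -ge0_integralD//; last 2 first.
  - by have /integrableP[] := integrable_abse (integrable_cauchy (X w)).
  - by have /integrableP[] := integrable_abse (integrable_cauchy (Y w)).
  apply: le_integral_pointwise => a _; rewrite -EFinD lee_fin.
  exact: gM.
apply: eq_integral => a /set_mem; rewrite /= in_itv/= andbT => a0.
under eq_integral do rewrite -h1_int//.
rewrite (@Fubini_probability _ _ _ _ _ _ (2 * a^-1)%R)//; last first.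
  move=> w; rewrite EFinM -integral_expRNM// -ge0_integralZl_EFin//; last first.
    by apply/measurable_EFinP/measurable_funTS; exact: mexp.
  apply: le_integral_pointwise => t _; rewrite -EFinM lee_fin /h1/= normrM.
  rewrite (ger0_norm (expR_ge0 _)) [leRHS]mulrC ler_pM2l ?expR_gt0//.
  by rewrite (_ : 2 = 1 + 1)%R//; apply: gM; exact: sin_max.
apply: eq_integral => t /set_mem; rewrite /= in_itv/= andbT => t0.
rewrite EFinM -EN// -integralZl//.
  apply: (@integrable_bounded _ _ _ P _ (1 + 1)%R).
    by apply: measurable_funM => //; apply: measurable_funB;
      apply: measurableT_comp => //; exact: measurable_funM.
  by move=> w; apply: gM; exact: sin_max.
Qed.

End sign_expectation.

(** * Elementary inequalities for real powers *)

Section power_inequalities.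
Context {R : realType}.
Implicit Types a x y z : R.

(* Average of the tangent-line bounds of expR at a * ln x, evaluated at ln x and 0. *)
Lemma powR_le_affine a x : 0 <= a <= 1 -> 0 < x -> x `^ a <= 1 + a * (x - 1).
Proof.
move=> /andP[a0 a1] x0; rewrite /powR gt_eqF//.
have xE : x = expR (ln x) by rewrite lnK ?posrE.
rewrite [in leRHS]xE; set L := ln x.
have tangent (u v : R) : expR v * (1 + (u - v)) <= expR u.
  have -> : expR u = expR v * expR (u - v) by rewrite -expRD addrC subrK.
  by rewrite ler_pM2l ?expR_gt0// expR_ge1Dx.
have := tangent L (a * L); have := tangent 0 (a * L); rewrite expR0.
set E := expR _; set X := expR _ => h0 h1.
have := ler_wpM2l a0 h1; have := ler_wpM2l (_ : 0 <= 1 - a) h0.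
by move=> /(_ ltac:(lra)); lra.
Qed.

Lemma powRV_sub1_le a y : 0 <= a <= 1 -> 0 < y -> (y `^ a)^-1 - 1 <= a * (1 - y) / y.
Proof.
move=> a01 y0; have -> : (y `^ a)^-1 = y^-1 `^ a.
  by rewrite -powRN -[y^-1]powR_inv1 ?ltW// -powRrM mulN1r.
have := powR_le_affine a (y^-1) a01; rewrite invr_gt0 => /(_ y0).
have -> : a * (1 - y) / y = a * (y^-1 - 1) by field; rewrite gt_eqF.
lra.
Qed.

Lemma powR_le1 a y : 0 <= a -> 0 < y <= 1 -> y `^ a <= 1.
Proof. by move=> a0 y01; have := ger_powR y01 a0; rewrite powRr0. Qed.

Lemma onem_powR_le a y : 0 <= a <= 1 -> 0 < y <= 1 -> 1 - y `^ a <= a * (1 - y) / y.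
Proof.
move=> a01 /andP[y0 y1]; apply: le_trans (powRV_sub1_le _ _ a01 y0).
have ya0 : 0 < y `^ a by exact: powR_gt0.
have ya1 : y `^ a <= 1 by apply: powR_le1; lra.
rewrite -subr_ge0.
have -> : (y `^ a)^-1 - 1 - (1 - y `^ a) = (1 - y `^ a) ^+ 2 / y `^ a.
  by field; rewrite gt_eqF.
by rewrite divr_ge0 ?sqr_ge0// ltW.
Qed.

(* With q for (1 - z) `^ a, the bound (1 - q) (1 - z) <= a z removes the factor 1 / z. *)
Lemma powR_1D_1B_le a z : 0 <= a <= 1 -> 0 < z < 1 ->
  (1 + z) `^ a - (1 - z) `^ a <= z * (2 * a + 1 - (1 - z) `^ a).
Proof.
move=> a01 /andP[z0 z1].
have := powR_le_affine a (1 + z) a01 ltac:(lra).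
have := onem_powR_le a (1 - z) a01 ltac:(lra).
rewrite ler_pdivlMr ?subr_gt0//.
set p := _ `^ _; set q := _ `^ _; lra.
Qed.

Lemma powRDl1 a x : 0 < x -> x `^ (1 + a) = x * x `^ a.
Proof.
move=> x0; rewrite powRD; first by rewrite powRr1 ?ltW.
by rewrite (gt_eqF x0) implybT.
Qed.

(** Bernoulli's inequality for the exponent 1 + a: the lower bound 1 - a z / (1 - z) for (1 - z)^a,
    multiplied by 1 - z. *)
Lemma powR1D_1B_ge a z : 0 <= a <= 1 -> 0 < z < 1 ->
  1 - (1 + a) * z <= (1 - z) `^ (1 + a).
Proof.
move=> a01 /andP[z0 z1].
have := onem_powR_le a (1 - z) a01 ltac:(lra).
rewrite ler_pdivlMr ?subr_gt0// powRDl1 ?subr_gt0//.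
by set q := _ `^ _; lra.
Qed.

End power_inequalities.

(** * The integral I and the outer integral *)

Section power_integrals.
Context {R : realType}.
Implicit Types a t x : R.
Local Open Scope ring_scope.
Let mu := @lebesgue_measure R.

(** By homogeneity this is [powR_1D_1B_le] at z = x / t. The factor 1 / x, singular at 0, becomes 1
    / t, and what remains has an elementary primitive. *)
Lemma near_integrand_le a t x : 0 < a <= 1 -> 0 < x < t ->
  ((x + t) `^ a - `|x - t| `^ a) / x <= ((2 * a + 1) * t `^ a - (t - x) `^ a) / t.
Proof.
move=> /andP[a0 a1] /andP[x0 xt]; have t0 : 0 < t by exact: lt_trans xt.
have z01 : 0 < x / t < 1 by rewrite divr_gt0//= ltr_pdivrMr ?mul1r.
have := powR_1D_1B_le a (x / t) ltac:(lra) z01.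
rewrite distrC ger0_norm ?subr_ge0 ?(ltW xt)//.
have -> : x + t = t * (1 + x / t) by field; rewrite gt_eqF.
have -> : t - x = t * (1 - x / t) by field; rewrite gt_eqF.
rewrite !powRM ?(ltW t0)//; [|lra|lra].
have : 0 < t `^ a by exact: powR_gt0.
move: z01; have -> : x = (x / t) * t by field; rewrite gt_eqF.
rewrite mulfK ?gt_eqF//; set z := x / t; set T := t `^ a.
set p := _ `^ _; set q := _ `^ _ => /andP[z0 _] T0 h.
rewrite -subr_ge0.
have -> : ((2 * a + 1) * T - T * q) / t - (T * p - T * q) / (z * t) =
    T / (z * t) * (z * (2 * a + 1 - q) - (p - q)) by field; rewrite !gt_eqF.
apply: mulr_ge0; last by rewrite subr_ge0.
apply: divr_ge0; first exact: ltW.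
by apply: mulr_ge0; exact: ltW.
Qed.

(** With y = t / x, [powR_1D_1B_le] would leave the term x^a (1 - (1 - y)^a) t / x^2, which has no
    convenient primitive. At the price of a summand a^2 the factor x^a is traded for the constant
    t^a, and (t / x^2) (1 - t / x)^a is an exact derivative up to the factor 1 + a. *)
Lemma far_integrand_le a t x : 0 < a <= 1 -> 0 < t < x ->
  ((x + t) `^ a - `|x - t| `^ a) / x <=
  t / x ^+ 2 * (2 * a * x `^ a + t `^ a * (1 + a ^+ 2 - (1 - t / x) `^ a)).
Proof.
move=> /andP[a0 a1] /andP[t0 tx]; have x0 : 0 < x by exact: lt_trans tx.
have y01 : 0 < t / x < 1 by rewrite divr_gt0//= ltr_pdivrMr ?mul1r.
have a01 : 0 <= a <= 1 by lra.
have := powR_1D_1B_le a (t / x) a01 y01.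
have := powRV_sub1_le a (t / x) a01 ltac:(lra).
have := onem_powR_le a (1 - t / x) a01 ltac:(lra).
rewrite ger0_norm ?subr_ge0 ?(ltW tx)//.
have -> : x + t = x * (1 + t / x) by field; rewrite gt_eqF.
have -> : x - t = x * (1 - t / x) by field; rewrite gt_eqF.
have -> : (x * (1 + t / x)) `^ a = x `^ a * (1 + t / x) `^ a.
  by rewrite powRM//; lra.
have -> : (x * (1 - t / x)) `^ a = x `^ a * (1 - t / x) `^ a.
  by rewrite powRM//; lra.
have xa0 : 0 < x `^ a by exact: powR_gt0.
have -> : t `^ a = x `^ a * (t / x) `^ a.
  by rewrite -powRM ?ltW// ?divr_gt0// mulrC divfK// gt_eqF.
have ya0 : 0 < (t / x) `^ a by apply: powR_gt0; lra.
have -> : t / x ^+ 2 = (t / x) / x by field; rewrite gt_eqF.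
have q1 : (1 - t / x) `^ a <= 1 by apply: powR_le1; lra.
move: y01 xa0 ya0 q1; set y := t / x; set X := x `^ a; set Y := y `^ a.
set p := (1 + y) `^ _; set q := (1 - y) `^ _.
move=> /andP[y0 y1] X0 Y0 q1; rewrite (_ : 1 - (1 - y) = y); last by ring.
move=> hq hY hp.
(* Equivalent to (1 / Y - 1) (1 - q) <= a^2; the two factors are at most a (1 - y) / y and a y / (1
   - y), whose product is a^2. *)
have key : (1 - q) <= Y * (1 - q + a ^+ 2).
  have : (Y^-1 - 1) * (1 - q) <= a ^+ 2.
    apply: (@le_trans _ _ ((a * (1 - y) / y) * (a * y / (1 - y)))).
      apply: ler_pM => //; rewrite ?subr_ge0// invf_ge1//.
      by apply: powR_le1; lra.
    by rewrite le_eqVlt; apply/orP; left; apply/eqP; field; rewrite !gt_eqF//; lra.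
  move=> /(ler_wpM2l (ltW Y0)).
  have -> : Y * ((Y^-1 - 1) * (1 - q)) = 1 - q - Y * (1 - q).
    by field; rewrite gt_eqF.
  lra.
rewrite -subr_ge0.
have -> : y / x * (2 * a * X + X * Y * (1 + a ^+ 2 - q)) - (X * p - X * q) / x =
    X / x * (y * (2 * a) + y * (Y * (1 - q + a ^+ 2)) - (p - q)).
  by field; rewrite gt_eqF.
apply: mulr_ge0; first by rewrite divr_ge0// ltW.
by have := ler_wpM2l (ltW y0) key; lra.
Qed.

Lemma is_derive_powR_comp (g : R -> R) (c x dg : R) : 0 < g x ->
  is_derive x (1 : R) g dg ->
  is_derive x (1 : R) (fun x => g x `^ c) (c * g x `^ (c - 1) * dg).
Proof.
move=> gx0 dgx; apply: (@is_derive1_comp R (fun y => y `^ c) g x) => //.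
exact: is_derive1_powR.
Qed.

Lemma near_integral_le a t : 0 < a <= 1 -> 0 < t ->
  (\int[mu]_(x in `]0%R, t[) (((x + t) `^ a - `|x - t| `^ a) / x)%:E <=
   (t `^ a * (2 * a + a / (1 + a)))%:E)%E.
Proof.
move=> a01 t0; have /andP[a0 a1] := a01.
pose f x := ((2 * a + 1) * t `^ a - (t - x) `^ a) / t.
pose F x := ((2 * a + 1) * t `^ a * x + (t - x) `^ (1 + a) / (1 + a)) / t.
apply: (@le_trans _ _ (\int[mu]_(x in `]0%R, t[) (f x)%:E)%E).
  apply: le_integral_pointwise => x; rewrite /= in_itv/= lee_fin.
  exact: near_integrand_le.
have dpow c (x : R) : x < t ->
    is_derive x (1 : R) (fun x => (t - x) `^ c) (- (c * (t - x) `^ (c - 1))).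
  move=> xt; have dx : is_derive x (1 : R) (fun x => t - x) (-1).
    by apply: is_derive_eq; ring.
  have := @is_derive_powR_comp (fun x => t - x) c x _ _ dx.
  by rewrite subr_gt0 mulrN1; apply.
have ta0 : 0 < t `^ a by exact: powR_gt0.
have pow_le x : 0 <= x < t -> (t - x) `^ a <= t `^ a.
  by move=> /andP[x0 xt]; apply: ge0_ler_powR; rewrite ?nnegrE; lra.
apply: (@ge0_integral_oo_le _ f F); first exact: t0.
- move=> x /andP[x0 xt]; rewrite divr_ge0 ?(ltW t0)//.
  have := pow_le x ltac:(lra); have := mulr_gt0 a0 ta0; lra.
- move=> x /andP[_ xt]; have dx := dpow a x xt.
  by apply: is_derive_continuous; rewrite /f.
- move=> x /andP[_ xt]; have dx := dpow (1 + a) x xt.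
  suff [] : is_derive x (1 : R) F (f x) by [].
  rewrite /F /f; apply: is_derive_eq; rewrite /GRing.scale/= (addrC 1 a) addrK.
  by field; rewrite !gt_eqF//; lra.
move=> x y x0 xy yt.
have zE z : 0 < z < t -> (t - z) `^ (1 + a) = (t - z) * (t - z) `^ a.
  by move=> z01; rewrite powRDl1// subr_gt0; lra.
(* The bound is the value of [F] at the right end t. *)
have Fy : F y <= (2 * a + 1) * t `^ a.
  rewrite /F zE; last lra.
  rewrite ler_pdivrMr// -subr_ge0.
  have -> : (2 * a + 1) * t `^ a * t -
     ((2 * a + 1) * t `^ a * y + (t - y) * (t - y) `^ a / (1 + a)) =
     (t - y) * ((2 * a + 1) * t `^ a - (t - y) `^ a / (1 + a)).
    by field; rewrite gt_eqF//; lra.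
  apply: mulr_ge0; first lra.
  rewrite subr_ge0 ler_pdivrMr; last lra.
  have := pow_le y ltac:(lra); have := mulr_gt0 a0 ta0.
  have := mulr_ge0 (mulr_ge0 (ltW a0) (ltW a0)) (ltW ta0); lra.
(* The bound is the value of [F] at 0; Bernoulli's inequality shows that [F] stays above it. *)
have Fx : t `^ a / (1 + a) <= F x.
  rewrite /F ler_pdivlMr//.
  have -> : t - x = t * (1 - x / t) by field; rewrite gt_eqF.
  have z01 : 0 < x / t < 1 by rewrite divr_gt0//= ltr_pdivrMr ?mul1r; lra.
  rewrite powRM ?(ltW t0)//; last lra.
  rewrite (powRDl1 a t t0).
  have := powR1D_1B_ge a (x / t) ltac:(lra) z01.
  set q := (1 - _) `^ _ => h.
  rewrite -subr_ge0.
  have -> : (2 * a + 1) * t `^ a * x + t * t `^ a * q / (1 + a) -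
      t `^ a / (1 + a) * t = t * t `^ a / (1 + a) *
      (q - (1 - (1 + a) * (x / t)) + (1 + a) * (2 * a) * (x / t)).
    by field; rewrite !gt_eqF//; lra.
  apply: mulr_ge0.
    by rewrite divr_ge0 ?mulr_ge0 ?(ltW t0) ?(ltW ta0)//; lra.
  apply: addr_ge0; first by rewrite subr_ge0.
  by apply: mulr_ge0; [apply: mulr_ge0|]; lra.
have -> : t `^ a * (2 * a + a / (1 + a)) =
    (2 * a + 1) * t `^ a - t `^ a / (1 + a) by field; rewrite gt_eqF//; lra.
lra.
Qed.

Lemma far_integral_le a t : 0 < a < 1 -> 0 < t ->
  (\int[mu]_(x in `]t, +oo[) (((x + t) `^ a - `|x - t| `^ a) / x)%:E <=
   (t `^ a * (a ^+ 2 + a / (1 + a) + 2 * a / (1 - a)))%:E)%E.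
Proof.
move=> /andP[a0 a1] t0.
pose f x := t / x ^+ 2 *
  (2 * a * x `^ a + t `^ a * (1 + a ^+ 2 - (1 - t / x) `^ a)).
pose F x := - (2 * a * t / (1 - a)) * x `^ (a - 1) -
  t `^ a * ((1 + a ^+ 2) * t * x^-1 + (1 - t * x^-1) `^ (1 + a) / (1 + a)).
apply: (@le_trans _ _ (\int[mu]_(x in `]t, +oo[) (f x)%:E)%E).
  apply: le_integral_pointwise => x; rewrite /= in_itv/= andbT lee_fin => tx.
  by apply: far_integrand_le; rewrite ?a0 ?t0// ltW.
have ta0 : 0 < t `^ a by exact: powR_gt0.
have y01 x : t < x -> 0 < t / x < 1.
  by move=> tx; rewrite divr_gt0 ?ltr_pdivrMr ?mul1r//; lra.
have dinv (x : R) : t < x -> is_derive x (1 : R) (fun x => x^-1) (- (x ^- 2)).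
  move=> tx; have x0 : x != 0 by rewrite gt_eqF//; lra.
  by have := is_deriveV x0 (is_derive_id x (1 : R)); rewrite /GRing.scale/= mulr1.
have dpow c (x : R) : t < x -> is_derive x (1 : R) (fun x => (1 - t * x^-1) `^ c)
    (c * (1 - t / x) `^ (c - 1) * (t / x ^+ 2)).
  move=> tx; have di := dinv x tx.
  have dx : is_derive x (1 : R) (fun x => 1 - t * x^-1) (t / x ^+ 2).
    by apply: is_derive_eq; rewrite /GRing.scale/=; ring.
  apply: (@is_derive_powR_comp (fun x => 1 - t * x^-1)) => //=.
  by have := y01 x tx; lra.
have dpx c (x : R) : t < x -> is_derive x (1 : R) (fun x => x `^ c) (c * x `^ (c - 1)).
  by move=> tx; apply: is_derive1_powR; lra.
have q1 x : t < x -> (1 - t / x) `^ a <= 1.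
  by move=> /y01 h; apply: powR_le1; lra.
apply: (@ge0_integral_oy_le _ f F).
- move=> x tx; have x0 : 0 < x by lra.
  rewrite /f mulr_ge0 ?divr_ge0 ?sqr_ge0 ?(ltW t0)//.
  rewrite addr_ge0// mulr_ge0 ?powR_ge0//; first lra.
  by have := q1 x tx; have := sqr_ge0 a; lra.
- move=> x tx; have di := dinv x tx; have d1 := dpow a x tx; have d2 := dpx a x tx.
  apply: (@is_derive_continuous _ f x); rewrite /f.
  have -> : (fun x => t / x ^+ 2 * (2 * a * x `^ a + t `^ a *
    (1 + a ^+ 2 - (1 - t / x) `^ a))) = (fun x => (t * (x^-1 * x^-1)) *
    (2 * a * x `^ a + t `^ a * (1 + a ^+ 2 - (1 - t * x^-1) `^ a))).
    by apply/funext => z; rewrite -invfM.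
  exact: is_derive_eq.
- move=> x tx; have di := dinv x tx; have d1 := dpow (1 + a) x tx.
  have d2 := dpx (a - 1) x tx; have x0 : 0 < x by lra.
  suff [] : is_derive x (1 : R) F (f x) by [].
  rewrite /F /f; apply: is_derive_eq; rewrite /GRing.scale/=.
  rewrite (_ : 1 + a - 1 = a); last by ring.
  have -> : x `^ (a - 1 - 1) = x `^ a / x ^+ 2.
    rewrite (_ : a - 1 - 1 = a - 2%:R); last by ring.
    by rewrite powRB ?powR_mulrn ?(ltW x0)// (gt_eqF x0) implybT.
  field; rewrite (gt_eqF x0)/=; apply/andP; split; rewrite gt_eqF//; lra.
move=> x y tx xy; have ty : t < y by lra.
(* The bound is the limit of [F] at infinity, again approached from below by Bernoulli's
   inequality. *)
have Fy : F y <= - (t `^ a / (1 + a)).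
  rewrite /F; have := powR1D_1B_ge a (t / y) ltac:(lra) (y01 _ ty).
  have := y01 _ ty; rewrite -!mulrA; set Y := t / y; set Q := (1 - Y) `^ _.
  move=> Y01 hQ.
  have : 0 <= 2 * (a * (t * (1 - a)^-1)) * y `^ (a - 1).
    by rewrite !mulr_ge0 ?powR_ge0 ?invr_ge0//; lra.
  have : 1 / (1 + a) <= (1 + a ^+ 2) * Y + Q / (1 + a).
    rewrite ler_pdivrMr; last lra.
    have -> : ((1 + a ^+ 2) * Y + Q / (1 + a)) * (1 + a) =
      (1 + a) * Y + Q + a ^+ 2 * (1 + a) * Y by field; rewrite gt_eqF//; lra.
    have : 0 <= a ^+ 2 * (1 + a) * Y.
      by apply: mulr_ge0; [apply: mulr_ge0; [exact: sqr_ge0|]|]; lra.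
    lra.
  move=> /(ler_wpM2l (ltW ta0)); rewrite mulNr; lra.
(* The bound is the value of [F] at the left end t, where the power of 1 - t / x vanishes. *)
have Fx : - (t `^ a * (2 * a / (1 - a) + (1 + a ^+ 2))) <= F x.
  have x0 : 0 < x by lra.
  have xa : t * x `^ (a - 1) <= t `^ a.
    rewrite powRB ?(gt_eqF x0) ?implybT// powRr1 ?(ltW x0)//.
    have xt : x `^ a <= t `^ a * (x / t).
      have xE : x = t * (x / t) by field; rewrite gt_eqF.
      have -> : x `^ a = t `^ a * (x / t) `^ a.
        by rewrite -powRM ?divr_ge0 ?(ltW t0) ?(ltW x0)// -xE.
      rewrite ler_pM2l//; apply: ler1_powR; last lra.
      by rewrite ler_pdivlMr// mul1r ltW.
    have := ler_wpM2r (divr_ge0 (ltW t0) (ltW x0)) xt.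
    have -> : t `^ a * (x / t) * (t / x) = t `^ a by field; rewrite !gt_eqF.
    by rewrite mulrCA.
  rewrite /F; have := y01 _ tx; rewrite -!mulrA; set X := t / x => X01.
  have : (1 - X) `^ (1 + a) <= 1 - X.
    rewrite powRDl1; last lra.
    by rewrite ler_piMr; [|lra|exact: q1].
  set Q := (1 - X) `^ _ => hQ.
  have : (1 + a ^+ 2) * X + Q / (1 + a) <= 1 + a ^+ 2.
    have : Q / (1 + a) <= 1 - X.
      rewrite ler_pdivrMr; last lra.
      have : 0 <= a * (1 - X) by rewrite mulr_ge0; lra.
      lra.
    have : 0 <= a ^+ 2 * (1 - X) by rewrite mulr_ge0 ?sqr_ge0; lra.
    lra.
  move=> /(ler_wpM2l (ltW ta0)).
  have : 0 <= 2 * a / (1 - a) by rewrite divr_ge0; lra.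
  move=> /ler_wpM2l /(_ _ _ xa).
  have -> : - (2 * (a * (t * (1 - a)^-1))) * x `^ (a - 1) =
    - (2 * a / (1 - a) * (t * x `^ (a - 1))) by ring.
  by rewrite mulrDr; lra.
have -> : t `^ a * (a ^+ 2 + a / (1 + a) + 2 * a / (1 - a)) =
    - (t `^ a / (1 + a)) + t `^ a * (2 * a / (1 - a) + (1 + a ^+ 2)).
  by field; apply/andP; split; rewrite gt_eqF//; lra.
lra.
Qed.

Lemma measurable_difference_quotient a t : measurable_fun [set: R]
  (fun x => ((x + t) `^ a - `|x - t| `^ a) / x).
Proof.
apply: measurable_funM; last exact: measurable_invr.
apply: measurable_funB; apply: (measurableT_comp (measurable_powR a)).
  exact: measurable_funD.
by apply: measurableT_comp => //; exact: measurable_funB.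
Qed.

(** The substitution x = t z identifies the left side with t^a I; the split at x = t is the split of
    I at z = 1. *)
Lemma difference_integral_le a t : 0 < a <= 5 / 100 -> 0 < t ->
  (\int[mu]_(x in `]0%R, +oo[) (((x + t) `^ a - `|x - t| `^ a) / x)%:E <=
   (27 / 4 * a * t `^ a)%:E)%E.
Proof.
move=> /andP[a0 a1] t0.
have a01 : 0 < a <= 1 by lra.
pose f x := ((x + t) `^ a - `|x - t| `^ a) / x.
have f_ge0 x : 0 < x -> 0 <= f x.
  move=> x0; rewrite divr_ge0 ?(ltW x0)// subr_ge0 ge0_ler_powR ?nnegrE//; try lra.
  by rewrite ler_norml; lra.
have mf : measurable_fun [set: R] f by exact: measurable_difference_quotient.
rewrite (@itv_bndbnd_setU _ _ _ (BLeft t)) ?bnd_simp ?(ltW t0)//.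
rewrite ge0_integral_setU//=; last 3 first.
- exact/measurable_EFinP/measurable_funTS.
- move=> x [|]; rewrite /= in_itv/= => /andP[? ?]; rewrite lee_fin; apply: f_ge0 => //.
  exact: lt_le_trans t0 _.
- by apply/disj_setPS => x /=; rewrite !in_itv/= => -[/andP[_ ?] /andP[? _]]; lra.
rewrite -[X in (_ + X <= _)%E]integral_itv_obnd_cbnd; last exact/measurable_EFinP/measurable_funTS.
apply: le_trans (leeD (near_integral_le a t a01 t0) (far_integral_le a t _ t0)) _.
  by lra.
rewrite -EFinD lee_fin -mulrDr mulrC ler_pM2r ?powR_gt0//.
(* The five terms add up to at most (2 + 1 + 1/20 + 1 + 22/10) a = 25/4 a, using a <= 1/20. *)
have h1 : a / (1 + a) <= a by rewrite ler_pdivrMr; nra.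
have h2 : 2 * a / (1 - a) <= 22 / 10 * a by rewrite ler_pdivrMr; nra.
nra.
Qed.

(** With w = t^a one has t^a dt / t = dw / a, so this is the integral of (e^(- k w) - e^(- k' w)) /
    a over w > 0. *)
Lemma exponential_difference_integral_le a k k' : 0 < a -> 0 < k <= k' ->
  (\int[mu]_(t in `]0%R, +oo[) (t `^ a * (expR (- (k * t `^ a)) - expR (- (k' * t `^ a))) / t)%:E <=
   ((k^-1 - k'^-1) / a)%:E)%E.
Proof.
move=> a0 /andP[k0 kk']; have k'0 : 0 < k' by exact: lt_le_trans kk'.
pose f t := t `^ a * (expR (- (k * t `^ a)) - expR (- (k' * t `^ a))) * t^-1.
pose F t := (expR (- (k' * t `^ a)) / k' - expR (- (k * t `^ a)) / k) / a.
have dpx c (x : R) : 0 < x -> is_derive x (1 : R) (fun x => x `^ c) (c * x `^ (c - 1)).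
  by move=> x0; exact: is_derive1_powR.
apply: (@ge0_integral_oy_le _ f F).
- move=> x x0; rewrite mulr_ge0 ?invr_ge0 ?(ltW x0)// mulr_ge0 ?powR_ge0//.
  by rewrite subr_ge0 ler_expR lerN2 ler_wpM2r ?powR_ge0.
- move=> x x0; have d1 := dpx a x x0.
  have x1 : x != 0 by rewrite gt_eqF.
  have di : is_derive x (1 : R) (fun x => x^-1) (- (x ^- 2)).
    by have := is_deriveV x1 (is_derive_id x (1 : R)); rewrite /GRing.scale/= mulr1.
  by apply: (@is_derive_continuous _ f x); rewrite /f; exact: is_derive_eq.
- move=> x x0; have d1 := dpx a x x0.
  suff [] : is_derive x (1 : R) F (f x) by [].
  rewrite /F /f; apply: is_derive_eq; rewrite /GRing.scale/=.
  have -> : x `^ (a - 1) = x `^ a / x.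
    by rewrite powRB ?powRr1 ?(ltW x0)// (gt_eqF x0) implybT.
  by field; rewrite !gt_eqF.
move=> x y x0 xy.
have Fy : F y <= 0.
  rewrite /F pmulr_lle0 ?invr_gt0// subr_le0.
  apply: ler_pM; rewrite ?expR_ge0 ?invr_ge0 ?(ltW k'0)//.
    by rewrite ler_expR lerN2 ler_wpM2r ?powR_ge0.
  by rewrite lef_pV2.
(* The bound is the value of [F] at t = 0. It follows from e^(- k w) being the power k / k' <= 1 of
   e^(- k' w), which lies below its tangent at 1. *)
have Fx : - ((k^-1 - k'^-1) / a) <= F x.
  rewrite /F -mulNr ler_pM2r ?invr_gt0//.
  set w := x `^ a.
  have := powR_le_affine (k / k') (expR (- (k' * w))) _ (expR_gt0 _).
  rewrite divr_ge0 ?(ltW k0) ?(ltW k'0)//= ler_pdivrMr// mul1r kk' => /(_ isT).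
  have -> : expR (- (k' * w)) `^ (k / k') = expR (- (k * w)).
    rewrite /powR gt_eqF ?expR_gt0// expRK; congr expR.
    by field; rewrite gt_eqF.
  set E := expR (- (k * w)); set E' := expR (- (k' * w)).
  move=> /(ler_wpM2r (_ : 0 <= k^-1)); rewrite invr_ge0 => /(_ (ltW k0)).
  have -> : (1 + k / k' * (E' - 1)) / k = k^-1 + E' / k' - k'^-1.
    by field; rewrite !gt_eqF.
  lra.
move: Fy Fx; move: (F x) (F y) => Fx Fy; lra.
Qed.

End power_integrals.

(** * A lower bound for pi *)

Section pi_bound.
Context {R : realType}.

Lemma sin_le (x : R) : 0 <= x -> sin x <= x.
Proof.
rewrite le_eqVlt => /predU1P[<-|x0]; first by rewrite sin0.
have [|c _] := @MVT R sin cos 0 x x0 (fun x _ => is_derive_sin x).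
  by apply: continuous_subspaceT; exact: continuous_sin.
rewrite sin0 !subr0 => ->; by rewrite ler_piMl ?(ltW x0)// cos_le1.
Qed.

(* The triple-angle formula forces sin (pi / 6) = 1 / 2. *)
Lemma pi_ge3 : 3 <= pi :> R.
Proof.
have p0 := pi_gt0 R.
pose x : R := pi / 6.
have s0 : 0 <= sin x by apply: sin_ge0_pi; rewrite /x; lra.
have : sin (x + x + x) = 1.
  by rewrite -(sin_pihalf R); congr sin; rewrite /x; lra.
rewrite !sinD !cosD.
have := cos2Dsin2 x; set c := cos x; set s := sin x => cs h.
have {}h : (s + 1) * (2 * s - 1) ^+ 2 = 0.
  have -> : (s + 1) * (2 * s - 1) ^+ 2 =
    1 - ((s * c + c * s) * c + (c * c - s * s) * s) +
    3 * s * (c ^+ 2 + s ^+ 2 - 1) by ring.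
  by rewrite h cs; ring.
have sx : s = 1 / 2.
  move/eqP: h; rewrite mulf_eq0 sqrf_eq0 => /orP[/eqP h|/eqP h]; last by lra.
  by move: s0; rewrite -/s; lra.
have := sin_le x; rewrite -/s sx /x => /(_ ltac:(lra)); lra.
Qed.

End pi_bound.

(** * Absence of atoms, and the bound on E[sg S sin (t S)] *)

Section key_bound.
Context {d : measure_display} {T : measurableType d} {R : realType}.
Variable P : probability T R.
Local Open Scope ereal_scope.
Let mu := @lebesgue_measure R.

Lemma measurable_comp_scale (f : R -> R) (X : T -> R) (t : R) :
  continuous f -> measurable_fun setT X -> measurable_fun setT (fun w => f (t * X w))%R.
Proof.
move=> cf mX; apply: (measurableT_comp (continuous_measurable_fun cf)).
exact: measurable_funM.
Qed.

(* Second moment of the average of cos (A Y), ..., cos (n A Y). *)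
Lemma probability_zero_le (Y : T -> R) (A e : R) (n : nat) :
  measurable_fun setT Y -> (0 <= e)%R -> (0 < n)%N ->
  (forall m : nat, (0 < m)%N -> \int[P]_w (cos (m%:R * A * Y w))%:E <= e%:E) ->
  P [set w | Y w = 0%R] <= (n%:R^-1 + e)%:E.
Proof.
move=> mY e0 n0 cfe.
pose u (m : nat) w : R := cos (m.+1%:R * A * Y w).
have mu_ m : measurable_fun setT (u m).
  by apply: measurable_comp_scale => //; exact: continuous_cos.
have u1 m w : (`|u m w| <= 1)%R by exact: cos_max.
have iu (m l : nat) : P.-integrable setT (fun w => (u m w * u l w)%:E).
  apply: (@integrable_bounded _ _ _ P _ 1%R); first exact: measurable_funM.
  by move=> w; rewrite normrM mulr_ile1.
have mZ : measurable [set w | Y w = 0%R].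
  rewrite -[X in measurable X]setTI.
  exact: (mY measurableT [set 0%R] (measurable_set1 _)).
have icos (m : nat) (c : R) : P.-integrable setT (fun w => (c * cos (m%:R * A * Y w))%:E).
  apply: (@integrable_bounded _ _ _ P _ `|c|%R).
    by apply: measurable_funM => //; apply: measurable_comp_scale => //; exact: continuous_cos.
  by move=> w; rewrite normrM ler_piMr ?cos_max.
have Euu m l : \int[P]_w (u m w * u l w)%:E <= ((m == l)%:R + e)%:E.
  have half_e (k : nat) : (0 < k)%N -> \int[P]_w (1 / 2 * cos (k%:R * A * Y w))%:E <= (e / 2)%:E.
    move=> k0; under eq_integral do rewrite EFinM.
    rewrite integralZl//; last by have := icos k 1%R; under eq_fun do rewrite mul1r.
    have -> : (e / 2)%:E = (1 / 2)%:E * e%:E by rewrite -EFinM; congr EFin; ring.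
    by rewrite lee_pmul2l ?lte_fin ?divr_gt0//; exact: cfe.
  (* Off the diagonal both frequencies are positive multiples of A, so the hypothesis applies to
     each cosine. *)
  have uE w : (u m w * u l w)%:E =
      (1 / 2 * cos (`|m - l|%N%:R * A * Y w))%:E +
      (1 / 2 * cos ((m.+1 + l.+1)%:R * A * Y w))%:E.
    rewrite -EFinD; congr EFin; rewrite /u.
    have -> : cos (`|m - l|%N%:R * A * Y w) =
        cos (m.+1%:R * A * Y w - l.+1%:R * A * Y w).
      have [lm|ml] := leqP l m.
        rewrite distnEl// natrB//; congr cos; rewrite -!natr1; ring.
      rewrite distnEr ?(ltnW ml)// natrB ?(ltnW ml)// -cosN; congr cos.
      by rewrite -!natr1; ring.
    by rewrite natrD !mulrDl cosB cosD; field.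
  under eq_integral do rewrite uE.
  rewrite integralD//; try exact: icos.
  have [<-|ml] := eqVneq m l.
    apply: (@le_trans _ _ (1%:E + (e / 2)%:E)); last by rewrite -EFinD lee_fin mulr1n; lra.
    apply: leeD; last exact: half_e.
    apply: (@le_trans _ _ (\int[P]_w 1%:E)).
      apply: le_integral_pointwise => w _; rewrite lee_fin.
      by have := cos_le1 (`|m - m|%N%:R * A * Y w)%R; lra.
    by rewrite integral_cst// mul1e probability_le1.
  have -> : (false%:R + e = e / 2 + e / 2)%R by rewrite mulr0n; lra.
  by rewrite EFinD; apply: leeD; apply: half_e; rewrite // lt0n distn_eq0.
have n0' : (0 < n%:R :> R)%R by rewrite ltr0n.
suff : (n%:R ^+ 2)%:E * P [set w | Y w = 0%R] <= (n%:R + n%:R ^+ 2 * e)%:E.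
  rewrite muleC -lee_pdivlMr ?exprn_gt0// => h; apply: le_trans h _.
  rewrite -EFinM lee_fin le_eqVlt; apply/orP; left; apply/eqP.
  by field; rewrite gt_eqF.
(* Where Y = 0 all n cosines equal 1, so the square of their sum is n^2; elsewhere it is
   nonnegative. *)
apply: (@le_trans _ _ (\int[P]_w (\sum_(m < n) \sum_(l < n) u m w * u l w)%:E)).
  rewrite -(setIT [set w | Y w = 0%R]) -integral_indic// -ge0_integralZl_EFin ?sqr_ge0//;
    [|exact/measurable_EFinP/measurable_indic].
  apply: le_integral_pointwise => w _; rewrite -EFinM lee_fin.
  rewrite -(_ : ((\sum_(m < n) u m w) ^+ 2 = \sum_(m < n) \sum_(l < n) u m w * u l w)%R); last first.
    by rewrite expr2 big_distrl/=; apply: eq_bigr => m _; rewrite big_distrr.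
  rewrite indicE; case: (boolP (w \in _)) => [/set_mem/= Yw|_]; last by rewrite mulr0 sqr_ge0.
  rewrite mulr1 (eq_bigr (fun=> 1%R)); last by move=> m _; rewrite /u Yw mulr0 cos0.
  by rewrite sumr_const card_ord.
under eq_integral do rewrite -sumEFin.
under eq_integral do under eq_bigr do rewrite -sumEFin.
rewrite integral_sum//; last first.
  by move=> m; apply: integrable_sum => // l _; exact: iu.
apply: (@le_trans _ _ (\sum_(m < n) \sum_(l < n) ((m == l)%:R + e)%:E)).
  apply: lee_sum => m _; rewrite integral_sum//; apply: lee_sum => l _; exact: Euu.
under eq_bigr do rewrite sumEFin.
rewrite sumEFin lee_fin (eq_bigr (fun=> 1 + n%:R * e)%R).
  by rewrite sumr_const card_ord -mulr_natl le_eqVlt; apply/orP; left; apply/eqP; ring.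
move=> m _; rewrite big_split/= sumr_const card_ord mulr_natl; congr (_ + _)%R.
rewrite (bigD1 m)//= eqxx big1 ?addr0// => l lm.
by rewrite eq_sym (negbTE lm).
Qed.

(** The characteristic function tends to 0 at infinity, so for a large base frequency A it is small
    at every positive multiple of A; averaging over many multiples then excludes an atom at 0. *)
Lemma stable_no_atom (Y : T -> R) (a k : R) :
  measurable_fun setT Y -> (0 < a)%R -> (0 < k)%R ->
  (forall t : R, \int[P]_w (cos (t * Y w))%:E = (expR (- (k * `|t| `^ a)))%:E) ->
  P [set w | Y w = 0%R] = 0.
Proof.
move=> mY a0 k0 cfY.
apply/eqP; rewrite eq_le measure_ge0 andbT.
apply/lee_addgt0Pr => e e0; rewrite add0e.
(* [A] solves k A^a = 2 / e, which is large enough because e^(- x) <= 1 / (1 + x) <= e / 2 once x >=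
   2 / e. *)
pose A : R := (((2 / e) / k) `^ a^-1)%R.
have A0 : (0 < A)%R by apply: powR_gt0; rewrite !divr_gt0.
have kA : (k * A `^ a = 2 / e)%R.
  rewrite /A -powRrM mulVf ?gt_eqF// powRr1 ?divr_ge0 ?(ltW k0) ?(ltW e0)//.
  by field; rewrite !gt_eqF.
have exp_le (x : R) : (2 / e <= x -> expR (- x) <= e / 2)%R.
  move=> ex; have x0 : (0 < x)%R by apply: lt_le_trans ex; rewrite divr_gt0.
  rewrite expRN -[leRHS]invrK lef_pV2 ?posrE ?invr_gt0 ?expR_gt0 ?divr_gt0//.
  rewrite invf_div (le_trans ex)// (le_trans _ (expR_ge1Dx _))//; lra.
pose n := (Num.truncn (2 / e)).+1.
apply: (@le_trans _ _ (n%:R^-1 + e / 2)%:E).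
  apply: (@probability_zero_le Y A) => //; first by rewrite divr_ge0// ltW.
  move=> m m0; rewrite cfY lee_fin; apply: exp_le.
  rewrite -kA ler_pM2l// ge0_ler_powR ?nnegrE ?(ltW a0) ?(ltW A0)//.
  rewrite normrM (gtr0_norm A0) ler_peMl ?(ltW A0)//.
  by rewrite ger0_norm ?ler0n// ler1n.
rewrite lee_fin.
suff : (n%:R^-1 <= e / 2)%R by lra.
rewrite -[leRHS]invrK lef_pV2 ?posrE ?ltr0n ?invr_gt0 ?divr_gt0// invf_div.
exact: ltW (truncnS_gt _).
Qed.

Lemma expR_difference_le (x y : R) : (0 <= x <= y)%R ->
  (0 <= expR (- x) - expR (- y) <= y - x)%R.
Proof.
move=> /andP[x0 xy]; rewrite subr_ge0 ler_expR lerN2 xy/=.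
have -> : expR (- y) = (expR (- x) * expR (- (y - x)))%R.
  by rewrite -expRD; congr expR; ring.
have ex1 : (expR (- x) <= 1)%R by rewrite -expR0 ler_expR; lra.
have ex0 := expR_gt0 (- x)%R.
have := expR_ge1Dx (- (y - x))%R; set E := expR (- (y - x)) => hE.
have E1 : (E <= 1)%R by rewrite -expR0 ler_expR; lra.
rewrite -[leLHS](_ : (expR (- x) * (1 - E) = _)%R); last by ring.
apply: (@le_trans _ _ (1 - E)%R); last by lra.
by rewrite ler_piMl// subr_ge0.
Qed.

(** The transform of sg S with weight sin (t S) only involves E[sin (t S) sin (x S)], which the
    characteristic function gives through the product-to-sum formula. *)
Lemma integral_sg_sin_bounds (S : T -> R) (a t : R) :
  measurable_fun setT S -> (0 < a <= 5 / 100)%R -> (0 < t)%R ->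
  (forall t : R, \int[P]_w (cos (t * S w))%:E = (expR (- (`|t| `^ a)))%:E) ->
  0 <= \int[P]_w (Num.sg (S w) * sin (t * S w))%:E <=
    (27 / 4 / pi * a * t `^ a)%:E.
Proof.
move=> mS a005 t0 cfS; have /andP[a0 a1] := a005.
have p0 := pi_gt0 R.
(* [M x] is E[sin (t S) sin (x S)]; [G] drops the exponentials and leads to the integral I. *)
pose M (x : R) : R := (1 / 2 * (expR (- (`|x - t| `^ a)) - expR (- ((x + t) `^ a))))%R.
pose G (x : R) : R := (1 / 2 * ((x + t) `^ a - `|x - t| `^ a))%R.
have MG (x : R) : (0 < x)%R -> (0 <= M x <= G x)%R.
  move=> x0.
  have h : (0 <= `|x - t| `^ a <= (x + t) `^ a)%R.
    rewrite powR_ge0/= ge0_ler_powR ?nnegrE ?(ltW a0)//; first lra.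
    by rewrite ler_norml; lra.
  by have := expR_difference_le _ _ h; rewrite /M /G; lra.
have mcos (c : R) : measurable_fun setT (fun w => cos (c * S w)).
  by apply: measurable_comp_scale => //; exact: continuous_cos.
have icos (c e : R) : P.-integrable setT (fun w => (e * cos (c * S w))%:E).
  apply: (@integrable_bounded _ _ _ P _ `|e|%R); first exact: measurable_funM.
  by move=> w; rewrite normrM ler_piMr ?cos_max.
have EM (x : R) : (0 < x)%R ->
    \int[P]_w (sin (t * S w) * (sin (x * S w) - sin (x * 0)))%:E = (M x)%:E.
  move=> x0.
  transitivity (\int[P]_w ((1 / 2 * cos ((x - t) * S w))%:E -
      (1 / 2 * cos ((x + t) * S w))%:E)).
    apply: eq_integral => w _; rewrite -EFinB; congr EFin.
    by rewrite mulr0 sin0 subr0 mulrBl mulrDl cosB cosD; field.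
  rewrite integralB//.
  have half c : \int[P]_w (1 / 2 * cos (c * S w))%:E = (1 / 2 * expR (- (`|c| `^ a)))%:E.
    under eq_integral do rewrite EFinM.
    rewrite integralZl ?cfS//.
    by have := icos c 1%R; under eq_fun do rewrite mul1r.
  by rewrite !half -EFinB /M mulrBr (@ger0_norm _ (x + t)%R) ?addr_ge0 ?(ltW x0) ?(ltW t0).
have msin (c : R) : measurable_fun setT (fun w => sin (c * S w)).
  by apply: measurable_comp_scale => //; exact: continuous_sin.
have := @expectation_sgB _ _ _ P (fun w => sin (t * S w))%R S (cst 0%R) M
  (msin t) mS (measurable_cst _) (fun w => sin_max _) EM.
have -> : \int[P]_w (sin (t * S w) * (Num.sg (S w) - Num.sg (cst 0 w)))%:E =
    \int[P]_w (Num.sg (S w) * sin (t * S w))%:E.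
  by apply: eq_integral => w _; rewrite sgr0 subr0 mulrC.
set I := \int[P]_w _ => IE.
have p2 : (0 < pi / 2 :> R)%R by lra.
apply/andP; split.
  rewrite -(@pmule_rge0 _ (pi / 2)%:E)// IE.
  apply: integral_ge0 => l _; apply: integral_ge0 => x; rewrite /= in_itv/= andbT => x0.
  by rewrite lee_fin mulr_ge0 ?expR_ge0//; case/andP: (MG x x0).
rewrite -(@lee_pmul2l _ (pi / 2)%:E)// IE.
have mF : measurable_fun [set: R] G.
  apply: measurable_funM => //.
  apply: measurable_funB; apply: (measurableT_comp (measurable_powR a)).
    exact: measurable_funD.
  by apply: measurableT_comp => //; exact: measurable_funB.
apply: (@le_trans _ _ (\int[mu]_(l in `]0%R, +oo[) \int[mu]_(x in `]0%R, +oo[)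
    (expR (- (l * x)) * G x)%:E)).
  apply: le_integral_pointwise => l _; apply: le_integral_pointwise => x.
  rewrite /= in_itv/= andbT => x0; rewrite lee_fin ler_pM2l ?expR_gt0//.
  by case/andP: (MG x x0).
rewrite integral_Laplace_div//; last first.
  by move=> x x0; case/andP: (MG x x0); exact: le_trans.
apply: (@le_trans _ _ ((1 / 2)%:E * (27 / 4 * a * t `^ a)%:E)); last first.
  rewrite -!EFinM lee_fin le_eqVlt; apply/orP; left; apply/eqP.
  by move: p0; move: (@pi R) => p p0; field; rewrite gt_eqF.
have half0 : 0 <= (1 / 2 : R)%:E by rewrite lee_fin; lra.
apply: le_trans (lee_wpmul2l half0 (difference_integral_le a t a005 t0)).
rewrite -ge0_integralZl_EFin//.
- by apply: le_integral_pointwise => x _; rewrite -EFinM lee_fin /G mulrA.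
- move=> x; rewrite /= in_itv/= andbT => x0; rewrite lee_fin.
  by case/andP: (MG x x0) => M0 MGx; rewrite divr_ge0 ?(ltW x0)//; rewrite /G in MGx; lra.
- apply/measurable_EFinP/measurable_funTS.
  exact: measurable_difference_quotient.
Qed.

End key_bound.

(** Generic in the measurable space, because it is applied both to [T] and to [T] with the
    sigma-algebra of a single column. The case S = 0 belongs to the event since a quotient by 0 is
    0. *)
Lemma measurable_ratio_event (d : measure_display) (T : measurableType d)
    (R : realType) (S Y : T -> R) (e : R) :
  measurable_fun setT S -> measurable_fun setT Y ->
  measurable [set w | S w = 0 \/ `|Y w| <= e * `|S w|].
Proof.
move=> mS mY; apply: measurableU.
  rewrite -[X in measurable X]setTI.
  exact: (mS measurableT [set 0] (measurable_set1 _)).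
have : measurable_fun setT (fun w => `|Y w| <= e * `|S w|).
  by apply: measurable_fun_ler; [|apply: measurable_funM => //]; exact: measurableT_comp.
by move=> /(_ measurableT [set true]); rewrite setTI; apply.
Qed.

(** * The probability that the ratio falls into an interval *)

Section ratio_bound.
Context {d : measure_display} {T : measurableType d} {R : realType}.
Variable P : probability T R.
Local Open Scope ereal_scope.
Let mu := @lebesgue_measure R.

(** If s and z have the same sign, z / v is monotone in v in the right direction; otherwise both
    differences have the sign of s. Nonnegativity lets half of this quantity dominate the indicator
    also off the event. *)
Lemma sg_ratio_ge0 (s z b c : R) : (0 < c < b)%R ->
  (0 <= Num.sg s * (Num.sg (s - z / b) - Num.sg (s - z / c)))%R.
Proof.
move=> /andP[c0 cb]; have b0 : (0 < b)%R by exact: lt_trans cb.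
have bc : (b^-1 <= c^-1)%R by rewrite lef_pV2// ltW.
have bV0 : (0 < b^-1)%R by rewrite invr_gt0.
have cV0 : (0 < c^-1)%R by rewrite invr_gt0.
have sg_mono (u v : R) : (u <= v)%R -> (Num.sg u <= Num.sg v)%R.
  move=> uv; case: (sgrP u); case: (sgrP v) => //; lra.
have [s0|s0|->] := ltgtP s 0%R; last by rewrite sgr0 mul0r.
- rewrite (ltr0_sg s0) mulN1r opprB subr_ge0.
  have [z0|z0] := lerP z 0%R.
    by apply: sg_mono; rewrite lerD2l lerN2 ler_wnM2l.
  have h1 : (0 < z / b)%R by rewrite mulr_gt0.
  have h2 : (0 < z / c)%R by rewrite mulr_gt0.
  by rewrite !ltr0_sg//; lra.
- rewrite (gtr0_sg s0) mul1r subr_ge0.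
  have [z0|z0] := lerP 0%R z.
    by apply: sg_mono; rewrite lerD2l lerN2 ler_wpM2l.
  have h1 : (z / b < 0)%R by rewrite pmulr_llt0.
  have h2 : (z / c < 0)%R by rewrite pmulr_llt0.
  by rewrite !gtr0_sg//; lra.
Qed.

(** The last hypothesis places z between c s and b s, and the nonvanishing conditions make the
    resulting inequalities strict. *)
Lemma sg_ratio_eq2 (s z b c x e : R) : (0 < e < x)%R ->
  b = (x + e)%R -> c = (x - e)%R -> (s != 0)%R ->
  (s - z / b != 0)%R -> (s - z / c != 0)%R -> (`|z - x * s| <= e * `|s|)%R ->
  (Num.sg s * (Num.sg (s - z / b) - Num.sg (s - z / c)) = 2)%R.
Proof.
move=> /andP[e0 ex] -> -> s_neq0 nb nc.
have b0 : (0 < x + e)%R by lra.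
have c0 : (0 < x - e)%R by lra.
rewrite ler_norml => /andP[h1 h2].
have [s0|s0|s0] := ltgtP s 0%R; last by rewrite s0 eqxx in s_neq0.
- move: h1 h2; rewrite (ltr0_norm s0) => h1 h2.
  have lb : (s - z / (x + e) < 0)%R.
    by rewrite lt_neqAle nb subr_le0 ler_pdivlMr//; lra.
  have gc : (0 < s - z / (x - e))%R.
    by rewrite lt_neqAle eq_sym nc subr_ge0 ler_pdivrMr//; lra.
  by rewrite (ltr0_sg s0) (ltr0_sg lb) (gtr0_sg gc); lra.
- move: h1 h2; rewrite (gtr0_norm s0) => h1 h2.
  have gb : (0 < s - z / (x + e))%R.
    by rewrite lt_neqAle eq_sym nb subr_ge0 ler_pdivrMr//; lra.
  have lc : (s - z / (x - e) < 0)%R.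
    by rewrite lt_neqAle nc subr_le0 ler_pdivlMr//; lra.
  by rewrite (gtr0_sg s0) (gtr0_sg gb) (ltr0_sg lc); lra.
Qed.

Lemma ratio_probability_le (S Z : T -> R) (a K x e : R) :
  measurable_fun setT S -> measurable_fun setT Z ->
  (forall f g : R -> R, measurable_fun setT f -> measurable_fun setT g ->
    (forall r, `|f r| <= 1)%R -> (forall r, `|g r| <= 1)%R ->
    \int[P]_w (f (S w) * g (Z w))%:E =
    (\int[P]_w (f (S w))%:E) * (\int[P]_w (g (Z w))%:E)) ->
  (0 < a <= 5 / 100)%R -> (0 < K)%R -> (0 < e < x)%R ->
  (forall t : R, \int[P]_w (cos (t * S w))%:E = (expR (- (`|t| `^ a)))%:E) ->
  (forall t : R, \int[P]_w (cos (t * Z w))%:E = (expR (- (K * `|t| `^ a)))%:E) ->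
  (forall t : R, \int[P]_w (sin (t * Z w))%:E = 0) ->
  P [set w | S w = 0%R \/ (`|Z w - x * S w| <= e * `|S w|)%R] <=
  (3 / 4 * (((x + e) `^ a - (x - e) `^ a) / K))%:E.
Proof.
move=> mS mZ ind a005 K0 ex cfS cfZ sfZ.
have /andP[a0 a1] := a005; have /andP[e0 ex'] := ex.
pose b : R := (x + e)%R; pose c : R := (x - e)%R.
have b0 : (0 < b)%R by rewrite /b; lra.
have c0 : (0 < c)%R by rewrite /c; lra.
have cb : (c < b)%R by rewrite /b /c; lra.
have csin := @continuous_measurable_fun R _ (@continuous_sin R).
have ccos := @continuous_measurable_fun R _ (@continuous_cos R).
have msinM (t : R) : measurable_fun [set: R] (fun r : R => sin (t * r)).
  by apply: measurableT_comp => //; exact: measurable_funM.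
have mcosM (t : R) : measurable_fun [set: R] (fun r : R => cos (t * r)).
  by apply: measurableT_comp => //; exact: measurable_funM.
have bsg (r : R) : (`|Num.sg r| <= 1)%R by rewrite normr_sg; case: (_ != _); rewrite ?ler01.
pose X (v : R) w := (S w - Z w / v)%R.
have mX v : measurable_fun setT (X v).
  by apply: measurable_funB => //; exact: measurable_funM.
(* The characteristic function of Z / v is exp (- k v |t|^a). *)
pose k (v : R) := (K / v `^ a)%R.
have k0 v : (0 < v)%R -> (0 < k v)%R by move=> v0; rewrite divr_gt0// powR_gt0.
have cfZv (v t : R) : (0 < v)%R ->
    \int[P]_w (cos (t / v * Z w))%:E = (expR (- (k v * `|t| `^ a)))%:E.
  move=> v0; rewrite cfZ; congr (expR (- _))%:E; rewrite /k normrM.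
  rewrite powRM// normfV (gtr0_norm v0) mulrAC -!mulrA; congr (K * (_ * _))%R.
  by rewrite -[(v^-1)%R]powR_inv1 ?(ltW v0)// -powRrM mulN1r powRN.
(* Shared by the addition formulas for the cosine and the sine of t (S - Z / v): independence
   factors both terms, and the one with the sine of Z has mean zero. *)
have split_int (f1 f2 : R -> R) (v t : R) : (0 < v)%R ->
    measurable_fun setT f1 -> measurable_fun setT f2 ->
    (forall r, `|f1 r| <= 1)%R -> (forall r, `|f2 r| <= 1)%R ->
    \int[P]_w (f1 (S w) * cos (t / v * Z w) + f2 (S w) * sin (t / v * Z w))%:E =
    \int[P]_w (f1 (S w))%:E * (expR (- (k v * `|t| `^ a)))%:E.
  move=> v0 mf1 mf2 f11 f21.
  under eq_integral do rewrite EFinD.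
  have i1 : P.-integrable setT (fun w => (f1 (S w) * cos (t / v * Z w))%:E).
    apply: (@integrable_bounded _ _ _ P _ 1%R).
      by apply: measurable_funM; apply: measurableT_comp => //; exact: measurable_funM.
    by move=> w; rewrite normrM mulr_ile1// cos_max.
  have i2 : P.-integrable setT (fun w => (f2 (S w) * sin (t / v * Z w))%:E).
    apply: (@integrable_bounded _ _ _ P _ 1%R).
      by apply: measurable_funM; apply: measurableT_comp => //; exact: measurable_funM.
    by move=> w; rewrite normrM mulr_ile1// sin_max.
  rewrite integralD//.
  rewrite (ind f1 (fun r => cos (t / v * r))) ?cfZv// => [|r]; last exact: cos_max.
  rewrite (ind f2 (fun r => sin (t / v * r))) ?sfZ// => [|r]; last exact: sin_max.
  by rewrite mule0 adde0.
(* S - Z / v is again symmetric stable up to scale, hence has no atom at 0. *)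
have cfX (v : R) : (0 < v)%R -> forall t : R, \int[P]_w (cos (t * X v w))%:E =
    (expR (- ((1 + k v) * `|t| `^ a)))%:E.
  move=> v0 t.
  transitivity (\int[P]_w (cos (t * S w) * cos (t / v * Z w) +
      sin (t * S w) * sin (t / v * Z w))%:E).
    apply: eq_integral => w _; rewrite -cosB; congr (cos _)%:E.
    by rewrite /X; ring.
  rewrite (split_int (fun r => cos (t * r)) (fun r => sin (t * r)))//.
  - by rewrite cfS -EFinM -expRD; congr (expR _)%:E; ring.
  - by move=> r; exact: cos_max.
  - by move=> r; exact: sin_max.
have null0 : P [set w | S w = 0%R] = 0.
  apply: (@stable_no_atom _ _ _ P S a 1%R) => // t.
  by rewrite cfS mul1r.
have nullX v : (0 < v)%R -> P [set w | X v w = 0%R] = 0.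
  move=> v0; apply: (@stable_no_atom _ _ _ P (X v) a (1 + k v)%R) => //.
    by rewrite addr_gt0 ?k0.
  exact: cfX.
have mzero (Y : T -> R) : measurable_fun setT Y -> measurable [set w | Y w = 0%R].
  move=> mY; rewrite -[X in measurable X]setTI.
  exact: (mY measurableT [set 0%R] (measurable_set1 _)).
pose E := [set w | S w = 0%R \/ (`|Z w - x * S w| <= e * `|S w|)%R].
(* The boundary cases, in which one of the three signs is 0. *)
pose Nul := [set w | S w = 0%R] `|` [set w | X b w = 0%R] `|` [set w | X c w = 0%R].
have m0 := mzero S mS; have mb := mzero (X b) (mX b); have mc := mzero (X c) (mX c).
have m0b := measurableU _ _ m0 mb.
have mN : measurable Nul by exact: measurableU.
have PN : P Nul = 0.
  rewrite /Nul (measureU0 m0b mc (nullX c c0)).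
  by rewrite (measureU0 m0 mb (nullX b b0)).
have mE : measurable E.
  apply: measurable_ratio_event => //.
  by apply: measurable_funB => //; exact: measurable_funM.
pose G w : R := (Num.sg (S w) * (Num.sg (X b w) - Num.sg (X c w)))%R.
have G0 w : (0 <= G w)%R by apply: sg_ratio_ge0; rewrite c0.
have PE : P E <= \int[P]_w (1 / 2 * G w)%:E.
  apply: (@le_trans _ _ (P ((E `\` Nul) `|` Nul))).
    apply: le_measure; rewrite ?inE//.
      by apply: measurableU => //; exact: measurableD.
    by move=> w Ew; have [|] := pselect (Nul w); [right|left].
  rewrite measureU0//; last exact: measurableD.
  rewrite -(setIT (E `\` Nul)) -integral_indic//; last exact: measurableD.
  apply: le_integral_pointwise => w _; rewrite lee_fin indicE.
  case: (boolP (w \in _)) => [/set_mem[Ew nN]|_]; last first.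
    by rewrite mulr_ge0//; lra.
  have [S0|Sw] := eqVneq (S w) 0%R; first by exfalso; apply: nN; left; left.
  case: Ew => [/eqP|Ew]; first by rewrite (negbTE Sw).
  rewrite /G /X (@sg_ratio_eq2 _ _ b c x e)//; first by rewrite mulr1n; lra.
    by apply/negP => /eqP h; apply: nN; left; right.
  by apply/negP => /eqP h; apply: nN; right.
apply: le_trans PE _.
have iG : P.-integrable setT (EFin \o G).
  apply: (@integrable_bounded _ _ _ P _ 2%R).
    apply: measurable_funM; first exact: (measurableT_comp measurable_sgr).
    by apply: measurable_funB; exact: (measurableT_comp measurable_sgr).
  move=> w; rewrite normrM (le_trans (ler_piMl _ (bsg _)))//.
  by rewrite (le_trans (ler_normB _ _))//; have := bsg (X b w); have := bsg (X c w); lra.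
pose m (t : R) := fine (\int[P]_w (Num.sg (S w) * sin (t * S w))%:E).
have mE' (t : R) : \int[P]_w (Num.sg (S w) * sin (t * S w))%:E = (m t)%:E.
  rewrite /m fineK//; apply: integrable_fin_num => //.
  apply: (@integrable_bounded _ _ _ P _ 1%R).
    apply: measurable_funM; first exact: (measurableT_comp measurable_sgr).
    by apply: (measurableT_comp csin); exact: measurable_funM.
  by move=> w; rewrite normrM mulr_ile1// sin_max.
have m_bd (t : R) : (0 < t)%R -> (0 <= m t <= 27 / 4 / pi * a * t `^ a)%R.
  by move=> t0; have := integral_sg_sin_bounds P S a t mS a005 t0 cfS;
    rewrite mE' !lee_fin.
pose D (t : R) : R := (expR (- (k b * t `^ a)) - expR (- (k c * t `^ a)))%R.
have kbc : (k b <= k c)%R.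
  rewrite ler_pM2l// lef_pV2 ?posrE ?powR_gt0//.
  by rewrite ge0_ler_powR ?nnegrE ?(ltW a0) ?(ltW b0) ?(ltW c0) ?(ltW cb).
have D0 (t : R) : (0 <= D t)%R.
  by rewrite subr_ge0 ler_expR lerN2 ler_wpM2r// powR_ge0.
have ED (t : R) : (0 < t)%R ->
    \int[P]_w (Num.sg (S w) * (sin (t * X b w) - sin (t * X c w)))%:E =
    (m t * D t)%:E.
  move=> t0.
  have sfX (v : R) : (0 < v)%R -> \int[P]_w (Num.sg (S w) * sin (t * X v w))%:E =
      (m t * expR (- (k v * t `^ a)))%:E.
    move=> v0.
    transitivity (\int[P]_w (Num.sg (S w) * sin (t * S w) * cos (t / v * Z w) +
        (- (Num.sg (S w) * cos (t * S w))) * sin (t / v * Z w))%:E).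
      apply: eq_integral => w _; congr EFin.
      have -> : (t * X v w = t * S w - t / v * Z w)%R by rewrite /X; ring.
      by rewrite sinB; ring.
    rewrite (split_int (fun r => Num.sg r * sin (t * r))%R
      (fun r => - (Num.sg r * cos (t * r)))%R)//.
    - by rewrite mE' -EFinM (gtr0_norm t0).
    - by apply: measurable_funM => //; exact: measurable_sgr.
    - apply: measurableT_comp => //.
      by apply: measurable_funM => //; exact: measurable_sgr.
    - by move=> r; rewrite normrM mulr_ile1// sin_max.
    - by move=> r; rewrite normrN normrM mulr_ile1// cos_max.
  have isX v : P.-integrable setT (fun w => (Num.sg (S w) * sin (t * X v w))%:E).
    apply: (@integrable_bounded _ _ _ P _ 1%R).
      apply: measurable_funM; first exact: (measurableT_comp measurable_sgr).
      by apply: (measurableT_comp csin); exact: measurable_funM.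
    by move=> w; rewrite normrM mulr_ile1// sin_max.
  under eq_integral do rewrite mulrBr EFinB.
  by rewrite integralB// !sfX// -EFinB -mulrBr.
have := @expectation_sgB _ _ _ P (fun w => Num.sg (S w)) (X b) (X c)
  (fun t => m t * D t)%R (measurableT_comp measurable_sgr mS) (mX b) (mX c)
  (fun w => bsg _) ED.
have p0 := pi_gt0 R; have p3 := @pi_ge3 R.
have p2 : (0 < pi / 2 :> R)%R by lra.
rewrite -/(G _) => GE.
pose C : R := (27 / 4 / pi * a)%R.
have C0 : (0 <= C)%R by rewrite mulr_ge0 ?(ltW a0)// divr_ge0 ?(ltW p0)//; lra.
have mpow : measurable_fun [set: R] (fun t : R => t `^ a)%R by exact: measurable_powR.
have mexpk (v : R) : measurable_fun [set: R] (fun t : R => expR (- (k v * t `^ a)))%R.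
  by apply: measurableT_comp => //; apply: measurableT_comp => //; exact: measurable_funM.
have mCD : measurable_fun [set: R] (fun t => t `^ a * D t)%R.
  by apply: measurable_funM => //; exact: measurable_funB.
have GB : (pi / 2)%:E * \int[P]_w (G w)%:E <=
    (C * (((k b)^-1 - (k c)^-1) / a))%:E.
  rewrite GE; apply: (@le_trans _ _ (\int[mu]_(l in `]0%R, +oo[)
      \int[mu]_(t in `]0%R, +oo[) (expR (- (l * t)) * (C * (t `^ a * D t)))%:E)).
    apply: le_integral_pointwise => l _; apply: le_integral_pointwise => t.
    rewrite /= in_itv/= andbT => t0; rewrite lee_fin ler_pM2l ?expR_gt0//.
    by rewrite mulrA ler_wpM2r//; case/andP: (m_bd t t0).
  rewrite integral_Laplace_div; last 2 first.
  - exact: measurable_funM.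
  - by move=> t t0; apply: mulr_ge0 => //; apply: mulr_ge0 (D0 t); exact: powR_ge0.
  have kk : (0 < k b <= k c)%R by rewrite k0.
  rewrite EFinM; have C0' : 0 <= C%:E by rewrite lee_fin.
  apply: le_trans (lee_wpmul2l C0' (exponential_difference_integral_le a (k b) (k c) a0 kk)).
  rewrite -ge0_integralZl_EFin//.
  - by apply: le_integral_pointwise => t _; rewrite -EFinM lee_fin -!mulrA.
  - move=> t; rewrite /= in_itv/= andbT => t0; rewrite lee_fin.
    apply: divr_ge0 (ltW t0).
    by apply: mulr_ge0 (D0 t); exact: powR_ge0.
  - apply/measurable_EFinP/measurable_funTS.
    by apply: measurable_funM => //; exact: measurable_invr.
under eq_integral do rewrite EFinM.
rewrite integralZl//.
have fG := integrable_fin_num measurableT iG.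
move: GB; rewrite -(fineK fG) -!EFinM !lee_fin.
set J := fine _; rewrite /C /k !invf_div.
have ba : (c `^ a <= b `^ a)%R.
  by rewrite ge0_ler_powR ?nnegrE ?(ltW a0) ?(ltW b0) ?(ltW c0) ?(ltW cb).
have -> : (27 / 4 / pi * a * ((b `^ a / K - c `^ a / K) / a) =
    27 / 4 / pi * ((b `^ a - c `^ a) / K))%R.
  by move: p0; move: (@pi R) => p p0; field; rewrite !gt_eqF.
have : (0 <= (b `^ a - c `^ a) / K)%R by rewrite divr_ge0 ?subr_ge0 ?(ltW K0).
rewrite -/b -/c; set Q := ((b `^ a - c `^ a) / K)%R => Q0.
move: p0 p3; move: (@pi R) => p p0 p3 {GE}.
move=> /(ler_wpM2r (ltW p0)).
have -> : (27 / 4 / p * Q * p = 27 / 4 * Q)%R by field; rewrite gt_eqF.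
have [J0 _|J0 h] := lerP J 0%R; first by lra.
(* From J pi^2 / 2 <= 27/4 Q and pi^2 >= 9 the factor becomes 27 / (4 * 9) = 3/4. *)
have : (9 <= p * p)%R by nra.
move=> /(ler_wpM2l (ltW J0)); lra.
Qed.

End ratio_bound.

(** * Linear combinations of independent stable variables *)

Section stable_sums.
Context {d : measure_display} {T : measurableType d} {R : realType}.
Variables (P : probability T R) (K : finType) (X : K -> {RV P >-> R}).
Local Open Scope ereal_scope.

Hypothesis indX : forall B : K -> set R, (forall k, measurable (B k)) ->
  P (\bigcap_(k in [set: K]) (X k @^-1` B k)) = \prod_k P (X k @^-1` B k).

(** Summing along a list allows adding one variable at a time. *)
Definition lin_comb (c : K -> R) (r : seq K) (w : T) : R := \sum_(k <- r) c k * X k w.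

Lemma measurable_lin_comb c r : measurable_fun setT (lin_comb c r).
Proof.
by apply: measurable_sum => k; exact: measurable_funM.
Qed.

(** Two blocks suffice: [k0] alone, and all other indices. As [r] avoids [k0], the combination is
    measurable for the second block. *)
Lemma independent_lin_comb (k0 : K) (c : K -> R) (r : seq K) (A B : set R) :
  k0 \notin r -> measurable A -> measurable B ->
  P (X k0 @^-1` A `&` lin_comb c r @^-1` B) =
  P (X k0 @^-1` A) * P (lin_comb c r @^-1` B).
Proof.
move=> k0r mA mB; pose beta (k : K) := k == k0.
pose E (b : bool) := if b then X k0 @^-1` A else lin_comb c r @^-1` B.
have := @product_rule_blocks _ _ _ P K bool X beta indX E.
have -> : \bigcap_(b in [set: bool]) E b = X k0 @^-1` A `&` lin_comb c r @^-1` B.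
  apply/seteqP; split => [w Ew|w [Aw Bw] [] _//].
  by split; [exact: (Ew true)|exact: (Ew false)].
rewrite big_bool => -> //.
case.
  rewrite [E true]/(X k0 @^-1` A) -[X in <<s _ >> X]setTI.
  have := @measurable_block_rectangles _ _ _ _ _ X beta k0.
  by rewrite /beta eqxx; apply.
rewrite [E false]/(lin_comb c r @^-1` B) -[X in <<s _ >> X]setTI.
suff : @measurable_fun _ _ (g_sigma_algebraType (block_rectangles X beta false)) R
    setT (lin_comb c r) by apply.
rewrite /lin_comb; clear E; elim: r k0r => [_|k r IH].
  rewrite [F in measurable_fun _ F](_ : _ = cst 0%R); first exact: measurable_cst.
  by apply/funext => w; rewrite big_nil.
rewrite inE negb_or eq_sym => /andP[kk0 k0r].
rewrite [F in measurable_fun _ F](_ : _ =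
    (fun w => c k * X k w + \sum_(j <- r) c j * X j w)%R); last first.
  by apply/funext => w; rewrite big_cons.
apply: measurable_funD; last exact: IH.
apply: measurable_funM => //.
have := @measurable_block_rectangles _ _ _ _ _ X beta k.
by rewrite /beta (negbTE kk0).
Qed.

(** Cosine and sine are treated together because the addition formulas mix them; the vanishing sine
    parts leave a product of exponentials. *)
Lemma cf_lin_comb (a : R) (c : K -> R) (r : seq K) (t : R) : uniq r ->
  (forall k t, \int[P]_w (cos (t * X k w))%:E = (expR (- (`|t| `^ a)))%:E) ->
  (forall k t, \int[P]_w (sin (t * X k w))%:E = 0) ->
  \int[P]_w (cos (t * lin_comb c r w))%:E =
    (expR (- ((\sum_(k <- r) `|c k| `^ a) * `|t| `^ a)))%:E /\
  \int[P]_w (sin (t * lin_comb c r w))%:E = 0.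
Proof.
move=> ur cfX sfX; rewrite /lin_comb; elim: r ur => [_|k r IH].
  rewrite big_nil mul0r oppr0 expR0; split.
    under eq_integral do rewrite big_nil mulr0 cos0.
    by rewrite integral_cst// mul1e [LHS]probability_setT.
  by apply: integral0_eq => w _; rewrite big_nil mulr0 sin0.
move=> /= /andP[kr ur]; have [cr sr] := IH ur.
have msin : measurable_fun [set: R] (fun y : R => sin (t * y)).
  apply: (measurableT_comp (continuous_measurable_fun (@continuous_sin R))).
  exact: measurable_funM.
have mcos : measurable_fun [set: R] (fun y : R => cos (t * y)).
  apply: (measurableT_comp (continuous_measurable_fun (@continuous_cos R))).
  exact: measurable_funM.
have msinc : measurable_fun [set: R] (fun y : R => sin (t * c k * y)).
  apply: (measurableT_comp (continuous_measurable_fun (@continuous_sin R))).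
  exact: measurable_funM.
have mcosc : measurable_fun [set: R] (fun y : R => cos (t * c k * y)).
  apply: (measurableT_comp (continuous_measurable_fun (@continuous_cos R))).
  exact: measurable_funM.
have mL := measurable_lin_comb c r.
have prodE (f g : R -> R) : measurable_fun setT f -> measurable_fun setT g ->
    (forall r, `|f r| <= 1)%R -> (forall r, `|g r| <= 1)%R ->
    P.-integrable setT (fun w => (f (X k w) * g (lin_comb c r w))%:E) /\
    \int[P]_w (f (X k w) * g (lin_comb c r w))%:E =
    \int[P]_w (f (X k w))%:E * \int[P]_w (g (lin_comb c r w))%:E.
  move=> mf mg f1 g1; split.
    apply: (@integrable_bounded _ _ _ P _ 1%R).
      by apply: measurable_funM; exact: measurableT_comp.
    by move=> w; rewrite normrM mulr_ile1.
  apply: (@integralM_independent_fun _ _ _ P _ _ _ _ 1%R) => // A B mA mB.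
  exact: independent_lin_comb.
have cosb (u y : R) : (`|cos (u * y)| <= 1)%R by exact: cos_max.
have sinb (u y : R) : (`|sin (u * y)| <= 1)%R by exact: sin_max.
have [icc Ecc] := prodE _ _ mcosc mcos (cosb _) (cosb _).
have [iss Ess] := prodE _ _ msinc msin (sinb _) (sinb _).
have [isc Esc] := prodE _ _ msinc mcos (sinb _) (cosb _).
have [ics Ecs] := prodE _ _ mcosc msin (cosb _) (sinb _).
have argE w : (t * (\sum_(j <- k :: r) c j * X j w) =
    t * c k * X k w + t * lin_comb c r w)%R.
  by rewrite big_cons mulrDr mulrA.
split.
  under eq_integral do rewrite argE cosD EFinB.
  rewrite integralB// Ecc Ess sfX mul0e sube0 cfX cr -EFinM -expRD.
  congr (expR _)%:E; rewrite big_cons normrM powRM//; ring.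
under eq_integral do rewrite argE sinD EFinD.
by rewrite integralD// Esc Ecs sfX mul0e add0e sr mule0.
Qed.

End stable_sums.

(** * Comparison of exponents *)

Section final_bound.
Context {R : realType}.
Implicit Types a b c th : R.

(** On (0, 1] a smaller exponent gives a larger power, and a / (1 + a) <= a <= a / (1 - a). The
    bound by 1 ensures that the factors of the product over the columns are nonnegative. *)
Lemma ratio_bound_le a b c th : 0 < a <= 5 / 100 -> 0 < c < b -> 0 < th ->
  (b / th) `^ (a / (1 - a)) < 1 / 3 ->
  3 / 4 * ((b `^ a - c `^ a) / th `^ a) <=
    3 / 4 * `|b / th| `^ (a / (1 + a)) * (1 - `|c / b| `^ (a / (1 - a))) <= 1.
Proof.
move=> /andP[a0 a1] /andP[c0 cb] th0 hu.
have b0 : 0 < b by exact: lt_trans cb.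
pose u := b / th; pose v := c / b.
have u0 : 0 < u by exact: divr_gt0.
have v0 : 0 < v by exact: divr_gt0.
have v1 : v < 1 by rewrite ltr_pdivrMr// mul1r.
have p0 : 0 <= a / (1 - a) by rewrite divr_ge0; lra.
(* If u exceeded 1, so would its power with nonnegative exponent be at least 1, against the bound
   1/3. *)
have u1 : u <= 1.
  rewrite leNgt; apply/negP => u1.
  by have := ler_powR (ltW u1) p0; rewrite powRr0 -/u in hu *; lra.
rewrite -/u -/v !gtr0_norm//.
have uE : b `^ a / th `^ a = u `^ a.
  rewrite /u powRM ?invr_ge0 ?(ltW b0) ?(ltW th0)//; congr (_ * _).
  by rewrite -[in RHS]powR_inv1 ?(ltW th0)// -powRrM mulN1r powRN.
have vE : c `^ a = b `^ a * v `^ a.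
  by rewrite -powRM ?(ltW b0) ?(ltW v0)// /v mulrC divfK ?gt_eqF.
have -> : (b `^ a - c `^ a) / th `^ a = u `^ a * (1 - v `^ a).
  by rewrite vE -uE; ring.
have u01 : 0 < u <= 1 by rewrite u0.
have v01 : 0 < v <= 1 by rewrite v0 ltW.
have hu1 : u `^ a <= u `^ (a / (1 + a)).
  by apply: ger_powR => //; rewrite ler_pdivrMr; nra.
have hu2 : u `^ (a / (1 + a)) <= 1.
  by apply: powR_le1 => //; rewrite divr_ge0; lra.
have hv1 : v `^ (a / (1 - a)) <= v `^ a.
  by apply: ger_powR => //; rewrite ler_pdivlMr; nra.
have hv2 : v `^ a <= 1 by apply: powR_le1 => //; lra.
have hv0 : 0 <= v `^ (a / (1 - a)) by exact: powR_ge0.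
have hu0 : 0 <= u `^ a by exact: powR_ge0.
move: hu1 hu2 hv1 hv2 hv0 hu0.
move: (u `^ a) (u `^ (a / (1 + a))) (v `^ a) (v `^ (a / (1 - a))) => U U' V V'.
move=> h1 h2 h3 h4 h5 h6; apply/andP; split.
  have : U * (1 - V) <= U' * (1 - V') by apply: ler_pM => //; lra.
  lra.
have : U' * (1 - V') <= 1 * 1 by apply: ler_pM; lra.
lra.
Qed.

End final_bound.

Lemma theta_powR (R : realType) (N : nat) (a : R) (x : 'I_N -> R) (i : 'I_N) :
  0 < a -> theta a x i `^ a = \sum_(k < N | k != i) `|x k| `^ a.
Proof.
move=> a0; rewrite /theta -powRrM div1r mulVf ?gt_eqF// powRr1//.
by apply: sumr_ge0 => k _; exact: powR_ge0.
Qed.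

(** * The event of the minimum estimator *)

Section xhat_event.
Context {d : measure_display} {T : measurableType d} {R : realType}.
Variable P : probability T R.

Lemma abs_div_le (y s e : R) : 0 <= e ->
  (`|y / s| <= e) <-> (s = 0 \/ `|y| <= e * `|s|).
Proof.
move=> e0; have [->|s0] := eqVneq s 0.
  by rewrite invr0 mulr0 normr0; split => // _; left.
rewrite normrM normfV ler_pdivrMr ?normr_gt0//.
by split => [|[/eqP|//]]; [right|rewrite (negbTE s0)].
Qed.

(** The minimum is at most e exactly when some column reaches e. The complement of an intersection
    is the form to which independence of the columns applies. *)
Lemma xhat_min_event (N M : nat) (hM : (0 < M)%N) (x : 'I_N -> R)
    (s : 'I_N -> 'I_M -> {RV P >-> R}) (i : 'I_N) (e : R) : 0 <= e ->
  [set w | `|xhat_min hM x s i w| <= e] =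
  ~` \bigcap_(j in [set: 'I_M])
    ~` [set w | s i j w = 0 \/ `|meas x s j w| <= e * `|s i j w|].
Proof.
move=> e0; rewrite setC_bigcap; under eq_bigcupr do rewrite setCK.
apply/seteqP; split => w /=.
  rewrite /xhat_min; set t := Order.arg_min _ _ _ => h.
  by exists t => //=; exact/abs_div_le.
move=> [j _ /= /(abs_div_le _ _ _ e0) h]; rewrite /xhat_min.
case: arg_minP => // t _ ht; exact: le_trans (ht j isT) h.
Qed.

End xhat_event.

(** * Independence of the columns and the bound for one column *)

Section column_bound.
Context {d : measure_display} {T : measurableType d} {R : realType}.
Variables (P : probability T R) (N M : nat) (s : 'I_N -> 'I_M -> {RV P >-> R}).
Hypothesis inds : mutually_independent s.

Let X (k : 'I_N * 'I_M) : {RV P >-> R} := s k.1 k.2.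

Lemma mutually_independent_pairs (B : 'I_N * 'I_M -> set R) :
  (forall k, measurable (B k)) ->
  P (\bigcap_(k in [set: 'I_N * 'I_M]) (X k @^-1` B k)) =
  (\prod_k P (X k @^-1` B k))%E.
Proof.
move=> mB; have := inds (fun i j => B (i, j)) (fun i j => mB (i, j)).
rewrite pair_bigA/= (eq_bigr (fun k => P (X k @^-1` B k))); last by case.
by move=> <-; congr (P _); apply: eq_bigcapr => -[].
Qed.

Lemma probability_columns (E : 'I_M -> set T) :
  (forall j, <<s block_rectangles X snd j >> (E j)) ->
  P (\bigcap_(j in [set: 'I_M]) E j) = (\prod_j P (E j))%E.
Proof. exact: (product_rule_blocks P _ _ X snd mutually_independent_pairs). Qed.

(** Independence of the columns asks for membership in the sigma-algebra of column [j], which is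
    stronger than measurability in [T]. *)
Lemma measurable_column_event (x : 'I_N -> R) (i : 'I_N) (e : R) (j : 'I_M) :
  <<s block_rectangles X snd j >>
    [set w | s i j w = 0 \/ `|meas x s j w| <= e * `|s i j w|].
Proof.
have mX k : @measurable_fun _ _ (g_sigma_algebraType (block_rectangles X snd j)) R
    setT (s k j) by exact: (measurable_block_rectangles X snd (k, j)).
apply: (@measurable_ratio_event _ (g_sigma_algebraType (block_rectangles X snd j))) => //.
rewrite /meas; apply: measurable_sum => k.
by apply: measurable_funM => //; exact: mX.
Qed.

Lemma column_probability_le (a e : R) (x : 'I_N -> R) (i : 'I_N) (j : 'I_M) :
  0 < a <= 5 / 100 -> (forall k j, is_SaS a (s k j)) -> 0 < e < `|x i| ->
  0 < theta a x i ->
  (P [set w | s i j w = 0%R \/ (`|meas x s j w| <= e * `|s i j w|)%R] <=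
  (3 / 4 * (((`|x i| + e) `^ a - (`|x i| - e) `^ a) / theta a x i `^ a))%:E)%E.
Proof.
move=> a005 SaS ex th0; have /andP[a0 _] := a005.
(* The factor - sg (x i) makes Z - |x i| S equal to - sg (x i) times the measurement, so that the
   event reads |Z - |x i| S| <= e |S| with a positive centre |x i|; it leaves the absolute values of
   the coefficients unchanged. *)
pose c (p : 'I_N * 'I_M) := - Num.sg (x i) * x p.1.
pose r := [seq (k, j) | k <- [seq k <- enum 'I_N | k != i]].
have xi0 : x i != 0 by rewrite -normr_gt0; lra.
have ur : uniq r.
  by rewrite map_inj_uniq; [apply: filter_uniq; exact: enum_uniq|move=> ? ? []].
have ijr : (i, j) \notin r.
  by apply/negP => /mapP[k]; rewrite mem_filter => /andP[ki _] [/eqP]; rewrite eq_sym (negbTE ki).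
have sumr (F : 'I_N * 'I_M -> R) : \sum_(p <- r) F p = \sum_(k < N | k != i) F (k, j).
  by rewrite big_map big_filter big_enum_cond.
have cfX k t : (\int[P]_w (cos (t * X k w))%:E = (expR (- (`|t| `^ a)))%:E)%E.
  by have [] := SaS k.1 k.2 t; rewrite unlock.
have sfX k t : (\int[P]_w (sin (t * X k w))%:E = 0)%E.
  by have [] := SaS k.1 k.2 t; rewrite unlock.
have cK : \sum_(k <- r) `|c k| `^ a = theta a x i `^ a.
  rewrite theta_powR// sumr; apply: eq_bigr => k _.
  by rewrite /c normrM normrN normr_sg xi0 mul1r.
have -> : [set w | s i j w = 0 \/ `|meas x s j w| <= e * `|s i j w|] =
    [set w | s i j w = 0 \/ `|lin_comb P _ X c r w - `|x i| * s i j w| <= e * `|s i j w|].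
  apply/seteqP; rewrite /mkset.
  suff h w : `|meas x s j w| = `|lin_comb P _ X c r w - `|x i| * s i j w|.
    by split => w; rewrite h.
  rewrite /lin_comb sumr /c /=.
  have -> : \sum_(k < N | k != i) - Num.sg (x i) * x k * s k j w -
      `|x i| * s i j w = - Num.sg (x i) * meas x s j w.
    rewrite /meas [in RHS](bigD1 i)//= mulrDr mulr_sumr [LHS]addrC; congr (_ + _).
      by rewrite normrEsg; ring.
    by apply: eq_bigr => k _; rewrite mulrA.
  by rewrite normrM normrN normr_sg xi0 mul1r.
apply: ratio_probability_le => //.
- exact: measurable_lin_comb.
- move=> f g mf mg f1 g1; apply: (@integralM_independent_fun _ _ _ P _ _ _ _ 1) => //.
    exact: measurable_lin_comb.
  move=> A B mA mB.
  exact: (independent_lin_comb P _ X mutually_independent_pairs (i, j)).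
- exact: powR_gt0.
- by move=> t; exact: (cfX (i, j)).
- by move=> t; rewrite -cK; have [] :=
    cf_lin_comb P _ X mutually_independent_pairs a c r t ur cfX sfX.
- by move=> t; have [] :=
    cf_lin_comb P _ X mutually_independent_pairs a c r t ur cfX sfX.
Qed.

End column_bound.

Theorem theorem3 (d : measure_display) (T : measurableType d) (R : realType)
  (P : probability T R) (alpha : R) (N M : nat) (hM : (0 < M)%N)
  (x : 'I_N -> R) (s : 'I_N -> 'I_M -> {RV P >-> R})
  (eps : R) (i : 'I_N) :
  0 < alpha -> alpha <= 5 / 100 ->
  mutually_independent s ->
  (forall k j, is_SaS alpha (s k j)) ->
  0 < eps -> eps < `|x i| ->
  0 < theta alpha x i ->
  ((`|x i| + eps) / theta alpha x i) `^ (alpha / (1 - alpha)) < 1 / 3 ->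
  (P [set w | (`|xhat_min hM x s i w| <= eps)%R] <=
  (1 - (1 - 3 / 4 * (`|(`|x i| + eps) / theta alpha x i| `^ (alpha / (1 + alpha)))
          * (1 - `|(`|x i| - eps) / (`|x i| + eps)| `^ (alpha / (1 - alpha)))) ^+ M)%:E)%E.
Proof.
move=> a0 a1 inds SaS e0 ex th0 hu.
have a005 : 0 < alpha <= 5 / 100 by rewrite a0.
have e0x : 0 < eps < `|x i| by rewrite e0.
have cb : 0 < `|x i| - eps < `|x i| + eps by apply/andP; split; lra.
have /andP[q_le q1] := ratio_bound_le _ _ _ _ a005 cb th0 hu.
set q := (3 / 4 * _ * _) in q_le q1 *.
pose E j := [set w | s i j w = 0 \/ `|meas x s j w| <= eps * `|s i j w|].
have sE j := measurable_column_event P _ _ s x i eps j.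
have mE j : measurable (E j).
  apply: measurable_ratio_event => //; apply: measurable_sum => k.
  exact: measurable_funM.
rewrite xhat_min_event ?(ltW e0)// -/E.
have mI : measurable (\bigcap_(j in [set: 'I_M]) ~` E j).
  by apply: fin_bigcap_measurable => // j _; exact: measurableC.
rewrite probability_setC// (probability_columns P _ _ s inds); last first.
  by move=> j; rewrite -setTD; exact: sigma_algebraCD.
rewrite EFinB leeB//.
have PE j : P (~` E j) = (1 - fine (P (E j)))%:E.
  by rewrite probability_setC// EFinB fineK//; exact: fin_num_measure.
under eq_bigr do rewrite PE.
rewrite prodEFin lee_fin -[M in _ ^+ M]card_ord -prodr_const.
(* The factors 1 - q are nonnegative because q <= 1, so the bounds for the single columns can be
   multiplied. *)
apply: ler_prod => j _; rewrite subr_ge0 q1/= lerD2l lerN2.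
rewrite -lee_fin fineK; last exact: fin_num_measure.
by apply: le_trans (column_probability_le P _ _ s inds _ _ _ _ j a005 SaS e0x th0) _; rewrite lee_fin.
Qed.
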